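(* Let $V=\bigcup_{k\ge0}\{1,2\}^k$ be the binary tree and let $(U^v)_{v\in V}$ be i.i.d. random variables uniformly distributed on $[0,1]$. Then there exists a family $(Y^v)_{v\in V}$ of random variables with values in $D=D[0,1]$, all having the same distribution, such that for every $v\in V$, almost surely, simultaneously for all $t\in[0,1]$, $$Y^v(t)=\mathbf 1_{t<U^v}\,U^v\,Y^{v1}\!\Big(\frac{t}{U^v}\Big)+\mathbf 1_{t\ge U^v}\Big(U^vY^{v1}(1)+(1-U^v)\,Y^{v2}\Big(\frac{t-U^v}{1-U^v}\Big)\Big)+C(t,U^v).$$
   Context: $V=\bigcup_{k\ge0}\{1,2\}^k$ is the rooted binary tree of finite words over $\{1,2\}$ (root the empty word $\emptyset$, $vi$ denotes the word $v$ followed by the letter $i$). $D=D[0,1]$ is the space of càdlàg functions $[0,1]\to\mathbb R$ (right continuous with left limits), with its Borel $\sigma$-field for the Skorokhod topology. The cost functions are $C(x)=1+2x\ln x+2(1-x)\ln(1-x)$ for $x\in[0,1]$ (with $0\ln0=0$) and, for $t,x\in[0,1]$, $C(t,x)=C(x)+2\,\mathbf 1_{t<x}\big(-1+x+(1-t)\ln(1-t)-(1-x)\ln(1-x)-(x-t)\ln(x-t)\big)$. *)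

(* Defs.v *)
From HB Require Import structures.
From mathcomp Require Import all_boot all_order all_algebra.
From mathcomp Require Import all_classical all_reals all_analysis.
Set Implicit Arguments. Unset Strict Implicit. Unset Printing Implicit Defensive.
Import Order.TTheory GRing.Theory Num.Theory.
Import numFieldNormedType.Exports.
Local Open Scope classical_set_scope.
Local Open Scope ring_scope.

Inductive letter := L1 | L2.
Definition letter_eqb (a b : letter) : bool :=
  match a, b with L1, L1 | L2, L2 => true | _, _ => false end.
Lemma letter_eqP : Equality.axiom letter_eqb.
Proof. by case; case; constructor. Qed.
HB.instance Definition _ := hasDecEq.Build letter letter_eqP.
Definition V := seq letter.
Definition vroot : V := [::].
Definition child (v : V) (i : letter) : V := rcons v i.

Definition xlnx {R : realType} (x : R) : R := if x == 0 then 0 else x * ln x.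

Definition Cost {R : realType} (x : R) : R :=
  1 + 2 * xlnx x + 2 * xlnx (1 - x).

Definition Cost2 {R : realType} (t x : R) : R :=
  Cost x + 2 * (if t < x then
                  -1 + x + xlnx (1 - t) - xlnx (1 - x) - xlnx (x - t)
                else 0).

(* A càdlàg function [0,1] -> R is encoded by its extension to R that is
   constant (= f 0) on (-oo,0) and constant (= f 1) on (1,+oo); this is a
   bijective encoding. *)
Definition cadlag01 {R : realType} (f : R -> R) : Prop :=
  (forall t : R, f x @[x --> t^'+] --> f t) /\
  (forall t : R, cvg (f x @[x --> t^'-])) /\
  (forall t : R, t < 0 -> f t = f 0) /\
  (forall t : R, 1 < t -> f t = f 1).

Definition Dspace (R : realType) := {f : R -> R | cadlag01 f}.

Definition Dval {R : realType} (f : Dspace R) : R -> R := proj1_sig f.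

Definition time_change {R : realType} (l : R -> R) : Prop :=
  {within `[0, 1], continuous l} /\
  {in `[0, 1] &, forall s t, s < t -> l s < l t} /\
  l 0 = 0 /\ l 1 = 1.

(* skor_lt f g e  <->  d(f,g) < e, where d is the Skorokhod J1 metric
   d(f,g) = inf_{l in Lambda} max( sup_t |l t - t|, sup_t |f t - g (l t)| ). *)
Definition skor_lt {R : realType} (f g : Dspace R) (e : R) : Prop :=
  exists l : R -> R, exists d : R, time_change l /\ d < e /\
    forall t : R, 0 <= t <= 1 ->
      `|l t - t| <= d /\ `|Dval f t - Dval g (l t)| <= d.

Definition skor_open {R : realType} (A : set (Dspace R)) : Prop :=
  forall f, A f -> exists2 e : R, 0 < e & forall g, skor_lt f g e -> A g.

Definition skor_borel {R : realType} : set (set (Dspace R)) :=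
  <<s [set A | skor_open A] >>.

Definition D_rv {d} {Omega : measurableType d} {R : realType}
    (Y : Omega -> Dspace R) : Prop :=
  forall B, skor_borel B -> measurable (Y @^-1` B).

Definition uniform01 {d} {Omega : measurableType d} {R : realType}
    (P : probability Omega R) (U : Omega -> R) : Prop :=
  measurable_fun setT U /\
  forall B : set R, measurable B ->
    P (U @^-1` B) = (@lebesgue_measure R) (B `&` `[0, 1]).

Definition mutually_independent {d} {Omega : measurableType d} {R : realType}
    {I : eqType} (P : probability Omega R) (X : I -> Omega -> R) : Prop :=
  forall (s : seq I) (B : I -> set R), uniq s ->
    (forall i, measurable (B i)) ->
    P (\bigcap_(i in [set` s]) (X i @^-1` B i)) =
      (\prod_(i <- s) P (X i @^-1` B i))%E.

(* Main.v *)
(* Iterate the fixed-point equation from Y_0 = 0: Y_n^v is the n-th iterate for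
   the tree of labels above v. At t = 1 the increment of Y_n is centred with
   second moment of order (2/3)^n, because E[U^2] + E[(1-U)^2] = 2/3 and the toll
   has mean zero. The supremum M_n over t of the increment satisfies
     M_{n+1} <= max(U M_n', U |increment of Y_n^{v1}(1)| + (1-U) M_n''),
   so that E[M_n^2] decays geometrically and Y_n converges uniformly almost
   surely, to a functional F of the labels above v. Translation of the labels
   along v preserves their law, hence the equality in distribution. For the Borel
   measurability of F: the n-th iterate is J1-continuous in the labels, hence a
   J1-limit of maps with countably many values, and F is a J1-limit of iterates. *)
Require Import Defs.
From HB Require Import structures.
From mathcomp Require Import all_boot all_order all_algebra.
From mathcomp Require Import all_classical all_reals all_analysis.
From mathcomp Require Import measurable_realfun ring lra.
Import Order.TTheory GRing.Theory Num.Theory.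
Import numFieldNormedType.Exports.
Local Open Scope classical_set_scope.
Local Open Scope ring_scope.
Set Implicit Arguments. Unset Strict Implicit. Unset Printing Implicit Defensive.

(** * The space of labelled trees *)

(** Two obstacles shape the proof. As a label u varies, the jump of [Cost2] at t = u moves, so the
    iterates are not continuous in the labels for the uniform norm; only a time change carrying one
    label to the other restores continuity. And the path space carries no convenient sigma-algebra
    on pairs of paths: this is met by maps with countably many values, for which the preimage of any
    set whatsoever is measurable. The supremum over t is never integrated. The function [sqr_bound]
    is an explicit recursion on the labels that dominates its square, so measurability is immediate
    and independence of the subtrees gives an exact recursion for its mean. The rates form a chain:
    9/8 * 2/3 = 3/4 for the mean of the squares, 7/8 > 3/4 for the squares almost surely, and 15/16
    for the increments, since 7/8 < (15/16)^2. Once the limit is a function of the labelled tree,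
    the recursion is a deterministic identity: probability enters only to discard labels outside
    ]0,1[ and trees whose bounds fail to decay. *)

Definition box {R : realType} (B : V -> set R) : set (V -> R) :=
  [set x | forall v, B v (x v)].

(** Cylinders are cut off at a level rather than at an arbitrary finite set of vertices:
    intersecting them and splitting them at the root then stay within the class. *)
Definition boxes {R : realType} : set (set (V -> R)) :=
  [set A | exists n, exists B : V -> set R,
    [/\ forall v, measurable (B v),
        forall v, (n <= size v)%N -> B v = setT & A = box B]].

Definition labels (R : realType) := g_sigma_algebraType (@boxes R).

(** The enumeration puts the root first, then the two subtrees, so that a product over [words n.+1]
    factors into a root term and two products over [words n]. *)
Fixpoint words (n : nat) : seq V :=
  if n is m.+1 then
    [::] :: [seq L1 :: v | v <- words m] ++ [seq L2 :: v | v <- words m]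
  else [::].

Lemma mem_words n v : (v \in words n) = (size v < n)%N.
Proof.
elim: n v => [|n IH] [|a v] //=; rewrite inE/= mem_cat.
have E b c : (c :: v \in [seq b :: w | w <- words n]) = (b == c) && (size v < n)%N.
  rewrite -IH; apply/mapP/andP => [[w wn [-> ->]]|[/eqP -> vn]]; first by rewrite eqxx.
  by exists v.
by rewrite !E ltnS; case: a => /=; rewrite ?orbF.
Qed.

Lemma uniq_words n : uniq (words n).
Proof.
elim: n => //= n IH; rewrite mem_cat cat_uniq !map_inj_uniq ?IH; try by move=> u v [].
rewrite andbT /= negb_or -andbA; apply/and3P; split.
- by apply/mapP => -[].
- by apply/mapP => -[].
- by apply/hasPn => _ /mapP[v _ ->]; apply/mapP => -[].
Qed.

Definition cons_labels {R : realType} (z : R * (labels R * labels R)) : labels R :=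
  fun v : V => match v with
       | [::] => z.1 | L1 :: u => z.2.1 u | L2 :: u => z.2.2 u end.

Definition subtree {R : realType} (i : letter) (x : labels R) : labels R :=
  fun v => x (i :: v).

Lemma boxesI (R : realType) : setI_closed (@boxes R).
Proof.
move=> _ _ [n [B [mB nB ->]]] [m [C [mC mC' ->]]].
exists (maxn n m), (fun v => B v `&` C v); split.
- by move=> v; exact: measurableI.
- by move=> v; rewrite geq_max => /andP[nv mv]; rewrite nB// mC'// setIT.
- apply/seteqP; split => x /=; first by move=> [xB xC] v; split.
  by move=> xBC; split => v; have [] := xBC v.
Qed.

Lemma boxesT (R : realType) : @boxes R setT.
Proof. by exists 0%N, (fun=> setT); split => //; apply/seteqP; split. Qed.

Lemma measurable_boxes (R : realType) (A : set (labels R)) :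
  boxes A -> measurable A.
Proof. by move=> bA; exact: sub_sigma_algebra. Qed.

Lemma measurable_to_labels d (T : measurableType d) (R : realType)
    (X : T -> labels R) :
  (forall v, measurable_fun setT (fun w => X w v)) -> measurable_fun setT X.
Proof.
move=> mX; apply: (@measurability _ _ T (labels R) setT X (@boxes R) erefl).
move=> _ [_ [n [B [mB nB ->]] <-]]; rewrite setTI.
have -> : X @^-1` (box B) =
    \bigcap_(v in [set` words n]) ((fun w => X w v) @^-1` B v).
  apply/seteqP; split=> w /= xw v; first by move=> _; exact: xw.
  have [nv|vn] := leqP n (size v); first by rewrite nB.
  by apply: xw; rewrite /= mem_words.
apply: fin_bigcap_measurable => // v _.
by rewrite -[X in measurable X]setTI; exact: mX.
Qed.

Lemma measurable_label (R : realType) (v : V) :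
  measurable_fun setT (fun x : labels R => x v).
Proof.
move=> _ B mB; rewrite setTI; apply: measurable_boxes.
exists (size v).+1, (fun u => if u == v then B else setT); split.
- by move=> u; case: ifP.
- by move=> u; case: eqP => // ->; rewrite ltnn.
- apply/seteqP; split=> x /=; first by move=> Bx u; case: eqP => // ->.
  by move=> /(_ v); rewrite eqxx.
Qed.

Lemma measurable_subtree (R : realType) i : measurable_fun setT (@subtree R i).
Proof. by apply: measurable_to_labels => v; exact: measurable_label. Qed.

Lemma measurable_cons_labels (R : realType) :
  measurable_fun setT (@cons_labels R).
Proof.
apply: measurable_to_labels => -[|[] v] /=.
- exact: measurable_fst.
- apply: (@measurableT_comp _ _ _ _ _ _ (fun x : labels R => x v) _
      (fun z : R * (labels R * labels R) => z.2.1)); first exact: measurable_label.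
  exact: (measurableT_comp measurable_fst measurable_snd).
- apply: (@measurableT_comp _ _ _ _ _ _ (fun x : labels R => x v) _
      (fun z : R * (labels R * labels R) => z.2.2)); first exact: measurable_label.
  exact: (measurableT_comp measurable_snd measurable_snd).
Qed.

(* The library registers [m1 \x m2] as a probability but not, for probabilities
   [m1] and [m2], as a sigma-finite measure; packing it restores the latter. *)
Definition prod_prob {d1 d2} {T1 : measurableType d1} {T2 : measurableType d2}
    {R : realType} (P1 : probability T1 R) (P2 : probability T2 R) :
  probability (T1 * T2)%type R := (P1 \x P2)%E.

Lemma prod_probE {d1 d2} {T1 : measurableType d1} {T2 : measurableType d2}
    {R : realType} (P1 : probability T1 R) (P2 : probability T2 R) A B :
  measurable A -> measurable B -> prod_prob P1 P2 (A `*` B) = (P1 A * P2 B)%E.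
Proof. by move=> mA mB; exact: product_measure1E. Qed.

(** * The law of the labels above a vertex *)

Section law.
Context {R : realType} {d : measure_display} {Omega : measurableType d}
  (P : probability Omega R) (U : V -> Omega -> R).
Hypotheses (unifU : forall v, uniform01 P (U v))
  (indU : mutually_independent P U).

Let mU v : measurable_fun setT (U v). Proof. by case: (unifU v). Qed.

Definition tree_above (v : V) (w : Omega) : labels R := fun u => U (v ++ u) w.

Lemma measurable_tree_above v : measurable_fun setT (tree_above v).
Proof. by apply: measurable_to_labels => u; exact: mU. Qed.

HB.instance Definition _ v := isMeasurableFun.Build _ _ _ _ (tree_above v)
  (measurable_tree_above v).
HB.instance Definition _ v := isMeasurableFun.Build _ _ _ _ (U v) (mU v).

Definition tree_law : probability (labels R) R :=
  distribution P (tree_above vroot).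
Definition label_law : probability R R := distribution P (U vroot).

Lemma label_lawE B : measurable B ->
  label_law B = lebesgue_measure (B `&` `[0, 1]).
Proof. by move=> mB; have [_] := unifU vroot; exact. Qed.

(** The right-hand side does not involve [v]; since boxes are a generating pi-system, this gives the
    invariance of the law under translation along the tree. *)
Lemma tree_above_box v n (B : V -> set R) :
  (forall u, measurable (B u)) -> (forall u, (n <= size u)%N -> B u = setT) ->
  P (tree_above v @^-1` box B) = (\prod_(u <- words n) label_law (B u))%E.
Proof.
move=> mB nB.
(* Independence is stated for events indexed by all vertices, so the constraints are moved from u to
   v ++ u; [drop (size v)] recovers u. *)
pose C w := if w \in [seq v ++ u | u <- words n] then B (drop (size v) w) else setT.
have mC w : measurable (C w) by rewrite /C; case: ifP.
have CE u : u \in words n -> C (v ++ u) = B u.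
  by move=> un; rewrite /C map_f// drop_size_cat.
have := @indU [seq v ++ u | u <- words n] C.
rewrite map_inj_uniq ?uniq_words; last first.
  by move=> a b /(congr1 (drop (size v))); rewrite !drop_size_cat.
move=> /(_ isT mC); rewrite big_map => E; transitivity (\prod_(u <- words n)
    P (U (v ++ u) @^-1` C (v ++ u)))%E; last first.
  rewrite big_seq [RHS]big_seq; apply: eq_bigr => u un; rewrite CE// label_lawE//.
  by have [_] := unifU (v ++ u); exact.
rewrite -E; congr (P _); apply/seteqP; split => w /=.
  by move=> wB _ /mapP[u un ->]; rewrite CE//; exact: wB.
move=> wC u; have [nu|un] := leqP n (size u); first by rewrite nB.
have := wC (v ++ u); rewrite /= CE ?mem_words//; apply.
by apply/mapP; exists u; rewrite ?mem_words.
Qed.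

Lemma tree_above_law v (A : set (labels R)) : measurable A ->
  P (tree_above v @^-1` A) = tree_law A.
Proof.
move=> mA; rewrite -[LHS]/(distribution P (tree_above v) A).
apply: (@measure_unique _ R (labels R) (@boxes R) (fun=> setT) _ _ _ _
  (distribution P (tree_above v)) tree_law) => //.
- exact: boxesI.
- by move=> _; exact: boxesT.
- by apply/seteqP; split => // x _; exists 0%N.
- move=> _ [n [B [mB nB ->]]].
  by rewrite /tree_law /= /distribution /pushforward !(tree_above_box _ mB nB).
- by move=> k; rewrite -ge0_fin_numE// fin_num_measure.
Qed.

Let rcv : measurable_fun setT (@cons_labels R). Proof. exact: measurable_cons_labels. Qed.
HB.instance Definition _ := isMeasurableFun.Build _ _ _ _ (@cons_labels R) rcv.

(** Self-similarity of the tree: the root label and the two subtrees are independent, each subtree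
    distributed as the whole. On a box both sides are the same finite product, regrouped. *)
Lemma tree_law_cons (A : set (labels R)) : measurable A ->
  tree_law A =
  prod_prob label_law (prod_prob tree_law tree_law) (cons_labels @^-1` A).
Proof.
move=> mA.
apply: (@measure_unique _ R (labels R) (@boxes R) (fun=> setT) _ _ _ _ tree_law
  (distribution (prod_prob label_law (prod_prob tree_law tree_law))
    (@cons_labels R))) => //.
- exact: boxesI.
- by move=> _; exact: boxesT.
- by apply/seteqP; split => // x _; exists 0%N.
- move=> _ [n [B [mB nB ->]]].
  have E : cons_labels @^-1` (box B) =
      B [::] `*` (box (B \o cons L1) `*` box (B \o cons L2)).
    apply/seteqP; split => -[t [x y]] /=.
      move=> xB; split; first exact: (xB [::]).
      by split => u; [exact: (xB (L1 :: u))|exact: (xB (L2 :: u))].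
    by move=> [Bt [Bx By]] -[|[] u] /=; [|exact: Bx|exact: By].
  have mbox i : measurable (box (B \o cons i) : set (labels R)).
    apply: measurable_boxes; exists n, (B \o cons i); split => //= v nv.
    by apply: nB; rewrite /= (leq_trans nv).
  transitivity (label_law (B [::]) *
      (tree_law (box (B \o cons L1)) * tree_law (box (B \o cons L2))))%E; last first.
    rewrite /distribution /pushforward /= E.
    by rewrite !prod_probE//; exact: measurableX.
  rewrite /tree_law /= /distribution /pushforward.
  have nB' i v : (n <= size v)%N -> (B \o cons i) v = setT.
    by move=> nv; apply: nB; rewrite /= (leq_trans nv).
  have mB' i v : measurable ((B \o cons i) v) by exact: mB.
  rewrite !(tree_above_box _ (mB' _) (nB' _)) ?(tree_above_box _ mB (n := n.+1))//; last first.
    by move=> v nv; apply: nB; exact: ltnW.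
  by rewrite /= big_cons big_cat/= !big_map.
- by move=> k; rewrite -ge0_fin_numE// fin_num_measure.
Qed.

End law.

(** * Expectations of products *)

Section bounded_measurable.
Context {d} {T : measurableType d} {R : realType}.

(** A class closed under sums and products on which every integral against a probability is finite,
    so that real-valued integrals may be computed algebraically. *)
Definition bdmeas (f : T -> R) :=
  measurable_fun setT f /\ exists M, forall x, `|f x| <= M.

Lemma bdmeas_cst (c : R) : bdmeas (fun=> c).
Proof. by split => //; exists `|c|. Qed.

Lemma bdmeasD f g : bdmeas f -> bdmeas g -> bdmeas (fun x => f x + g x).
Proof.
move=> [mf [M fM]] [mg [N gN]]; split; first by apply: measurable_funD.
by exists (M + N) => x; rewrite (le_trans (ler_normD _ _))// lerD.
Qed.

Lemma bdmeasM f g : bdmeas f -> bdmeas g -> bdmeas (fun x => f x * g x).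
Proof.
move=> [mf [M fM]] [mg [N gN]]; split; first exact: measurable_funM.
by exists (M * N) => x; rewrite normrM ler_pM.
Qed.

Lemma bdmeasB f g : bdmeas f -> bdmeas g -> bdmeas (fun x => f x - g x).
Proof.
move=> bf bg; have := bdmeasD bf (bdmeasM (bdmeas_cst (-1)) bg).
by congr bdmeas; apply/funext => x; rewrite mulN1r.
Qed.

Lemma bdmeas_integrable (P : probability T R) f :
  bdmeas f -> P.-integrable setT (EFin \o f).
Proof.
move=> [mf [M fM]]; apply: (@le_integrable _ _ _ _ _ _ _ (EFin \o cst M)) => //.
- exact: measurableT_comp.
- by move=> x _; rewrite lee_fin (le_trans (fM x))// ler_norm.
- exact: (finite_measure_integrable_cst P).
Qed.

Lemma bdmeas_integral (P : probability T R) f :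
  bdmeas f -> (\int[P]_x (f x)%:E)%E = (\int[P]_x f x)%:E.
Proof.
by move=> bf; rewrite fineK//; apply: integrable_fin_num => //; exact: bdmeas_integrable.
Qed.

Lemma bd_RintegralD (P : probability T R) f g : bdmeas f -> bdmeas g ->
  \int[P]_x (f x + g x) = \int[P]_x f x + \int[P]_x g x.
Proof. by move=> bf bg; rewrite RintegralD//; exact: bdmeas_integrable. Qed.

Lemma bd_RintegralZ (P : probability T R) c f : bdmeas f ->
  \int[P]_x (c * f x) = c * \int[P]_x f x.
Proof. by move=> bf; rewrite RintegralZl//; exact: bdmeas_integrable. Qed.

Lemma Rintegral_cst1 (P : probability T R) c : \int[P]_x c = c.
Proof. by rewrite Rintegral_cst//= probability_setT mulr1. Qed.

End bounded_measurable.

Lemma bdmeas_comp {d d'} {T : measurableType d} {T' : measurableType d'}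
    {R : realType} (h : T -> T') (f : T' -> R) :
  measurable_fun setT h -> bdmeas f -> bdmeas (fun x => f (h x)).
Proof.
move=> mh [mf [M fM]]; split; last by exists M.
exact: measurableT_comp.
Qed.

Lemma Rintegral_prod {d1 d2} {T1 : measurableType d1} {T2 : measurableType d2}
    {R : realType} (P1 : probability T1 R) (P2 : probability T2 R) f g :
  bdmeas f -> bdmeas g ->
  \int[prod_prob P1 P2]_z (f z.1 * g z.2) = (\int[P1]_x f x) * (\int[P2]_y g y).
Proof.
move=> bf bg.
have bfg : bdmeas (fun z : T1 * T2 => f z.1 * g z.2).
  by apply: bdmeasM; apply: bdmeas_comp.
apply/EFin_inj; rewrite -bdmeas_integral//.
rewrite -(@integral12_prod_meas1 _ _ _ _ _ P1 P2 (fun z => (f z.1 * g z.2)%:E)); last first.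
  exact: (bdmeas_integrable (prod_prob P1 P2) bfg).
rewrite EFinM -!bdmeas_integral// /fubini_F /=.
transitivity (\int[P1]_x ((f x)%:E * \int[P2]_y (g y)%:E))%E.
  apply: eq_integral => x _; under eq_integral do rewrite EFinM.
  by rewrite integralZl//; exact: bdmeas_integrable.
rewrite bdmeas_integral// integralZr//; exact: bdmeas_integrable.
Qed.

Section cons_law.
Context {R : realType} (mu : probability R R) (nu : probability (labels R) R).
Hypothesis nu_cons : forall A : set (labels R), measurable A ->
  nu A = prod_prob mu (prod_prob nu nu) (cons_labels @^-1` A).

Let mcl : measurable_fun setT (@cons_labels R).
Proof. exact: measurable_cons_labels. Qed.
HB.instance Definition _ :=
  isMeasurableFun.Build _ _ _ _ (@cons_labels R) mcl.

(** Replace [nu] by the image under [cons_labels] of the product law, then apply Fubini twice. Every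
    expectation of the moment recursions is an instance. *)
Lemma Rintegral_cons f g h : bdmeas f -> bdmeas g -> bdmeas h ->
  \int[nu]_x (f (x [::]) * (g (subtree L1 x) * h (subtree L2 x))) =
  (\int[mu]_t f t) * ((\int[nu]_x g x) * (\int[nu]_x h x)).
Proof.
move=> bf bg bh.
have bF : bdmeas (fun x : labels R =>
    f (x [::]) * (g (subtree L1 x) * h (subtree L2 x))).
  apply: bdmeasM; first by apply: bdmeas_comp bf; exact: measurable_label.
  by apply: bdmeasM; [apply: bdmeas_comp bg|apply: bdmeas_comp bh];
    exact: measurable_subtree.
have bgh : bdmeas (fun z : labels R * labels R => g z.1 * h z.2).
  by apply: bdmeasM; apply: bdmeas_comp.
rewrite -!Rintegral_prod//.
congr fine.
rewrite (@eq_measure_integral _ _ _ _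
  (distribution (prod_prob mu (prod_prob nu nu)) (@cons_labels R))); last first.
  by move=> A mA _; exact: nu_cons.
rewrite integral_distribution//.
  by apply: measurableT_comp => //; case: bF.
apply: (bdmeas_integrable _ (f := (fun x : labels R =>
    f (x [::]) * (g (subtree L1 x) * h (subtree L2 x))) \o cons_labels)).
exact: (bdmeas_comp mcl bF).
Qed.

End cons_law.

(** * The cost functions *)

Section costs.
Context {R : realType}.
Implicit Types x y t u : R.

Lemma xlnxE x : xlnx x = x * ln x.
Proof. by rewrite /xlnx; case: eqP => // ->; rewrite mul0r. Qed.

Lemma xlnx_npos x : x <= 0 -> xlnx x = 0.
Proof. by move=> x0; rewrite xlnxE ln0// mulr0. Qed.

Lemma ln_le_subr1 x : 0 < x -> ln x <= x - 1.
Proof.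
move=> x0; have := @le_ln1Dx R (x - 1); rewrite (_ : 1 + (x - 1) = x); last by ring.
by apply; lra.
Qed.

(** With s = sqrt x, the inequality ln y <= y - 1 at y = 1/s gives s ln s >= s - 1 >= -1, and x ln x
    = 2 s (s ln s). *)
Lemma xlnx_ge_sqrt x : 0 <= x -> - (2 * Num.sqrt x) <= xlnx x.
Proof.
rewrite le_eqVlt => /predU1P[<-|x0]; first by rewrite xlnx_npos// sqrtr0; lra.
have s0 : 0 < Num.sqrt x by rewrite sqrtr_gt0.
have xE : x = Num.sqrt x * Num.sqrt x by rewrite -expr2 sqr_sqrtr// ltW.
rewrite xlnxE {2 3}xE; move: (Num.sqrt x) s0 => s s0.
have := ln_le_subr1 (x := s^-1); rewrite invr_gt0 => /(_ s0).
rewrite lnV ?posrE// lnM ?posrE// => h.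
have : s * (s^-1 - 1 + ln s) >= 0 by apply: mulr_ge0; [exact: ltW|lra].
have -> : s * (s^-1 - 1 + ln s) = 1 - s + s * ln s by field; rewrite gt_eqF.
by nra.
Qed.

(** Negative arguments are harmless because [xlnx] vanishes there. For 0 <= y and h = x - y,
    monotonicity of ln gives the lower bound h ln h >= -2 sqrt h; for the upper bound, y (ln (y + h)
    - ln y) <= h and h ln (y + h) <= 0. *)
Lemma xlnx_holder x y : x <= 1 -> y <= 1 ->
  `|xlnx x - xlnx y| <= 2 * Num.sqrt `|x - y|.
Proof.
wlog yx : x y / y <= x.
  move=> H x1 y1; have [/H|/ltW /H] := leP y x; first exact.
  by rewrite distrC (distrC x); exact.
move=> x1 y1.
wlog y0 : y yx y1 / 0 <= y.
  move=> H; have [/H|y0] := leP 0 y; first exact.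
  rewrite (xlnx_npos (ltW y0)).
  have [x0|x0] := leP x 0.
    by rewrite xlnx_npos// subrr normr0 mulr_ge0// sqrtr_ge0.
  have := H 0 (ltW x0) ler01 (lexx _); rewrite (@xlnx_npos 0)// => /le_trans; apply.
  by rewrite ler_pM2l// ler_sqrt ?normr_ge0// subr0 !ger0_norm; lra.
rewrite [X in Num.sqrt X]ger0_norm; last by rewrite subr_ge0.
pose h := x - y; have -> : x = y + h by rewrite /h; lra.
have h0 : 0 <= h by rewrite /h; lra.
have xh : y + h <= 1 by rewrite /h; lra.
rewrite addrAC subrr add0r.
have [->|hn0] := eqVneq h 0; first by rewrite addr0 subrr normr0 sqrtr0 mulr0.
have {hn0}hp : 0 < h by rewrite lt_def hn0.
have hs : h <= Num.sqrt h.
  have s1 : Num.sqrt h <= 1 by rewrite -[leRHS]sqrtr1 ler_sqrt//; lra.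
  have := sqr_sqrtr h0; have := sqrtr_ge0 h; nra.
have hl := xlnx_ge_sqrt h0; move: hl; rewrite !xlnxE => hl.
have lnxh : ln (y + h) <= 0 by apply: ln_le0; lra.
rewrite ler_norml; apply/andP; split.
  apply: (le_trans hl).
  have : ln h <= ln (y + h) by rewrite ler_ln ?posrE//; lra.
  move: y0; rewrite le_eqVlt => /predU1P[<-|y0]; first by rewrite mul0r subr0 add0r.
  have : ln y <= ln (y + h) by rewrite ler_ln ?posrE//; lra.
  by move=> a b; nra.
move: y0; rewrite le_eqVlt => /predU1P[E|y0]; first by rewrite -E mul0r subr0; rewrite -E in lnxh *; nra.
have : ln ((y + h) / y) <= (y + h) / y - 1 by apply: ln_le_subr1; rewrite divr_gt0//; lra.
rewrite ln_div ?posrE//; last lra.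
have -> : (y + h) / y - 1 = h / y by field; rewrite gt_eqF.
move=> H; have : y * (ln (y + h) - ln y) <= y * (h / y) by rewrite ler_pM2l.
have -> : y * (h / y) = h by field; rewrite gt_eqF.
by nra.
Qed.

Lemma xlnx_bound x : x <= 1 -> `|xlnx x| <= 1.
Proof.
move=> x1; have [x0|x0] := leP x 0; first by rewrite xlnx_npos// normr0.
rewrite xlnxE ler_norml; apply/andP; split; last first.
  have : ln x <= 0 by apply: ln_le0; lra.
  by nra.
have := ln_le_subr1 (x := x^-1); rewrite invr_gt0 => /(_ x0).
rewrite lnV ?posrE// => h.
have : 0 <= x * (x^-1 - 1 + ln x) by apply: mulr_ge0; [exact: ltW|lra].
by rewrite mulrDr mulrBr divff ?gt_eqF//; lra.
Qed.

Lemma xlnx_unif_continuous (e : R) : 0 < e -> exists2 d, 0 < d &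
  forall x y, x <= 1 -> y <= 1 -> `|x - y| < d -> `|xlnx x - xlnx y| < e.
Proof.
move=> e0; exists ((e / 2) ^+ 2); first by rewrite exprn_gt0// divr_gt0.
move=> x y x1 y1 xy; apply: le_lt_trans (xlnx_holder x1 y1) _.
have : Num.sqrt `|x - y| < Num.sqrt ((e / 2) ^+ 2).
  by rewrite ltr_sqrt// exprn_gt0// divr_gt0.
by rewrite sqrtr_sqr [X in _ < X]ger0_norm; lra.
Qed.

Lemma continuous_xlnx : continuous (@xlnx R).
Proof.
move=> x; have [x0|x0] := ltP 0 x.
  have -> : @xlnx R = (fun x => x * ln x) by apply/funext => y; exact: xlnxE.
  by apply: cvgM => //; exact: continuous_ln.
apply/cvgrPdist_lt => e e0.
have [d d0 H] := xlnx_unif_continuous e0.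
near=> y; apply: H; first by rewrite (le_trans x0).
- near: y; apply: filterS (nbhsx_ballx x 1 ltr01) => y.
  rewrite /ball /= ltr_distlC => /andP[_ h].
  by apply: ltW; apply: lt_le_trans h _; rewrite gerDr.
- by near: y; exact: (@nbhsx_ballx _ _ x d).
Unshelve. all: by end_near. Qed.

(* Labels outside ]0, 1[ form a null set; clipping makes every construction
   below total in the labels. *)
Definition clip (u : R) : R := if 0 < u < 1 then u else 2^-1.

Lemma clip_gt0 u : 0 < clip u.
Proof. by rewrite /clip; case: ifP => [/andP[]//|_]; rewrite invr_gt0. Qed.

Lemma clip_lt1 u : clip u < 1.
Proof. by rewrite /clip; case: ifP => [/andP[]//|_]; rewrite invf_lt1// ltr1n. Qed.

Lemma clip_id u : 0 < u < 1 -> clip u = u.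
Proof. by rewrite /clip => ->. Qed.

Lemma measurable_clip : measurable_fun setT clip.
Proof.
apply: measurable_fun_if => //.
by apply: measurable_and => //; exact: measurable_fun_ltr.
Qed.

Lemma continuous_Cost : continuous (@Cost R).
Proof.
have c1 : continuous (fun x : R => 1 - x).
  by move=> x; apply: cvgB => //; exact: cvg_cst.
move=> x; apply: cvgD; first (apply: cvgD; first exact: cvg_cst).
  by apply: cvgM; [exact: cvg_cst|exact: continuous_xlnx].
apply: cvgM; first exact: cvg_cst.
by apply: (@continuous_comp _ _ _ (fun x : R => 1 - x)); [exact: c1|exact: continuous_xlnx].
Qed.

Lemma Cost_bound x : 0 <= x -> x <= 1 -> `|Cost x| <= 5.
Proof.
move=> x0 x1; rewrite /Cost.
have := xlnx_bound x1; have : `|xlnx (1 - x)| <= 1 by apply: xlnx_bound; lra.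
by rewrite !ler_norml => /andP[? ?] /andP[? ?]; apply/andP; split; lra.
Qed.

Lemma Cost2_bound t x : 0 <= t -> t <= 1 -> 0 <= x -> x <= 1 -> `|Cost2 t x| <= 13.
Proof.
move=> t0 t1 x0 x1; rewrite /Cost2; have := Cost_bound x0 x1.
have : `|xlnx (1 - t)| <= 1 by apply: xlnx_bound; lra.
have : `|xlnx (1 - x)| <= 1 by apply: xlnx_bound; lra.
have : `|xlnx (x - t)| <= 1 by apply: xlnx_bound; lra.
rewrite !ler_norml => /andP[? ?] /andP[? ?] /andP[? ?] /andP[? ?].
by case: ifP => _; apply/andP; split; lra.
Qed.

Lemma Cost21 x : x < 1 -> Cost2 1 x = Cost x.
Proof. by move=> x1; rewrite /Cost2 ltNge (ltW x1)/= mulr0 addr0. Qed.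

Lemma bdmeas_clip : bdmeas clip.
Proof.
split; first exact: measurable_clip.
by exists 1 => x; rewrite gtr0_norm ?clip_gt0// ltW// clip_lt1.
Qed.

Lemma bdmeas_Cost_clip : bdmeas (fun u => Cost (clip u)).
Proof.
split; last first.
  by exists 5 => x; apply: Cost_bound; apply: ltW; [exact: clip_gt0|exact: clip_lt1].
apply: measurableT_comp measurable_clip.
exact: continuous_measurable_fun continuous_Cost.
Qed.

(** * Integrals against the uniform law *)

Section uniform.
Variable mu : probability R R.
Hypothesis mu_unif : forall B, measurable B ->
  mu B = lebesgue_measure (B `&` `[0, 1]).

Lemma mu_oo01 : mu `]0, 1[%classic = 1%E.
Proof.
rewrite mu_unif// setIidl; last exact: subset_itv_oo_cc.
by rewrite lebesgue_measure_itv/= lte_fin ltr01 sube0.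
Qed.

(* [R] and [measurableTypeR R], on which [lebesgue_measure] lives, carry the
   same sigma-algebra under two displays. *)
Let TR := measurableTypeR R.
Let idTR : R -> TR := idfun.
Let midTR : measurable_fun setT idTR.
Proof. by move=> _ B mB; rewrite setTI. Qed.
HB.instance Definition _ := isMeasurableFun.Build _ _ _ _ idTR midTR.

(** The fundamental theorem of calculus on ]0,1[, which has full mass and where [clip] is the
    identity. Differentiability is asked only in the interior because it is there that the
    derivative of ln is available for the toll. *)
Lemma Rintegral_clip (f F : R -> R) : continuous f -> continuous F ->
  {in `]0, 1[, forall x, is_derive x 1 F (f x)} ->
  bdmeas (f \o clip) ->
  \int[mu]_u f (clip u) = F 1 - F 0.
Proof.
move=> cf cF dF bf; apply/EFin_inj; rewrite -bdmeas_integral//.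
have mN : mu (~` `]0, 1[%classic) = 0.
  by rewrite probability_setC// mu_oo01 subee.
pose mu' : probability TR R := distribution mu idTR.
transitivity (\int[mu']_x (f (clip x))%:E)%E.
  apply/esym; apply: (@integral_distribution _ _ _ _ _ mu idTR (fun u => (f (clip u))%:E)).
    by apply: measurableT_comp => //; case: bf.
  exact: (bdmeas_integrable mu bf).
have mN' : mu' (~` `]0, 1[%classic) = 0 by [].
have bf' : bdmeas (f \o clip : TR -> R) by [].
rewrite (negligible_integral _ _ _ mN')//;
  [|exact: measurableC|exact: (bdmeas_integrable mu' bf')].
rewrite setTD setCK.
rewrite (@eq_measure_integral _ _ _ _ lebesgue_measure); last first.
  move=> A mA A01; rewrite [LHS]mu_unif//; congr lebesgue_measure.
  by apply: setIidl; apply: subset_trans A01 _; exact: subset_itv_oo_cc.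
transitivity (\int[lebesgue_measure]_(x in `]0%R, 1%R[) (f x)%:E)%E.
  apply: eq_integral; by move=> x; rewrite inE/= in_itv/= => x01; rewrite clip_id.
have mf : measurable_fun setT f by exact: continuous_measurable_fun.
rewrite integral_itv_obnd_cbnd; last first.
  by apply: measurable_funTS; exact: measurableT_comp.
rewrite integral_itv_bndo_bndc; last first.
  by apply: measurable_funTS; exact: measurableT_comp.
rewrite (continuous_FTC2 (F := F))//.
- by apply: continuous_subspaceT.
- split; first by move=> x /dF[].
  + exact: cvg_at_right_filter (cF _).
  + exact: cvg_at_left_filter (cF _).
- move=> x /dF H; rewrite derive1E; exact: derive_val.
Qed.

Lemma Rintegral_clip_sqr : \int[mu]_u (clip u * clip u) = 3^-1.
Proof.
rewrite (@Rintegral_clip (fun x => x * x) (fun x => 3^-1 * x ^+ 3)).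
- by rewrite expr1n expr0n/= mulr0 subr0 mulr1.
- by move=> x; apply: cvgM.
- by move=> x; apply: cvgM; [exact: cvg_cst|exact: exprn_continuous].
- by move=> x _; apply: is_derive_eq; rewrite /GRing.scale/=; field.
- exact: bdmeasM bdmeas_clip bdmeas_clip.
Qed.

Lemma Rintegral_clipC_sqr : \int[mu]_u ((1 - clip u) * (1 - clip u)) = 3^-1.
Proof.
have c1 : continuous (fun x : R => 1 - x).
  by move=> x; apply: cvgB => //; exact: cvg_cst.
rewrite (@Rintegral_clip (fun x => (1 - x) * (1 - x)) (fun x => - 3^-1 * (1 - x) ^+ 3)).
- by rewrite subrr subr0 expr1n expr0n/= mulr0 sub0r mulr1 opprK.
- by move=> x; apply: cvgM; exact: c1.
- move=> x; apply: cvgM; first exact: cvg_cst.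
  by apply: (@continuous_comp _ _ _ (fun x : R => 1 - x) (fun y => y ^+ 3));
    [exact: c1|exact: exprn_continuous].
- by move=> x _; apply: is_derive_eq; rewrite /GRing.scale/=; field.
- have b := bdmeasB (bdmeas_cst 1) bdmeas_clip; by apply: bdmeasM.
Qed.

Lemma Rintegral_Cost_clip : \int[mu]_u Cost (clip u) = 0.
Proof.
(* An antiderivative of 2 x ln x, written with [xlnx] so that it is continuous at 0. The
   antiderivative x + G x - G (1 - x) of the cost takes the value 1/2 at both ends. *)
pose G x := (x * xlnx x) - 2^-1 * x ^+ 2 : R.
have cG : continuous G.
  move=> x; apply: cvgB; first by apply: cvgM => //; exact: continuous_xlnx.
  by apply: cvgM; [exact: cvg_cst|exact: exprn_continuous].
have c1 : continuous (fun x : R => 1 - x).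
  by move=> x; apply: cvgB => //; exact: cvg_cst.
have dG x : 0 < x -> is_derive x 1 G (2 * xlnx x).
  move=> x0; have -> : G = fun x => x ^+ 2 * ln x - 2^-1 * x ^+ 2.
    by apply/funext => y; rewrite /G xlnxE expr2 mulrA.
  have := is_derive1_ln x0 => ?.
  apply: is_derive_eq; rewrite /GRing.scale/= xlnxE; field.
  by rewrite gt_eqF.
rewrite (@Rintegral_clip Cost (fun x => x + G x - G (1 - x))).
- by rewrite subrr subr0 /G xlnxE ln1 (@xlnx_npos 0)//; field.
- exact: continuous_Cost.
- move=> x; apply: cvgB; first by apply: cvgD => //; exact: cG.
  by apply: (@continuous_comp _ _ _ (fun x : R => 1 - x) G); [exact: c1|exact: cG].
- move=> x; rewrite in_itv/= => /andP[x0 x1]; have d1 := dG _ x0.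
  have d2 : is_derive x 1 (fun x => G (1 - x)) (- (2 * xlnx (1 - x))).
    have x1' : 0 < 1 - x by lra.
    have := dG _ x1' => d3.
    have d4 : is_derive x 1 (fun x : R => 1 - x) (-1).
      by apply: is_derive_eq; ring.
    have := @is_derive1_comp _ G (fun x => 1 - x) x _ _ d3 d4.
    by rewrite mulrN1.
  by apply: is_derive_eq; rewrite /Cost opprK.
- exact: bdmeas_Cost_clip.
Qed.

End uniform.

End costs.

(** * Moment bounds *)

Section moments.
Context {R : realType}.

(* The k-th increment of the iteration, evaluated at t = 1. *)
Fixpoint endpoint_incr (k : nat) (x : labels R) : R :=
  if k is j.+1 then
    clip (x [::]) * endpoint_incr j (subtree L1 x) +
    (1 - clip (x [::])) * endpoint_incr j (subtree L2 x)
  else Cost (clip (x [::])).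

(* Bounds the square of the supremum over t of the k-th increment; the weights
   9/8 and 9 come from (a + b)^2 <= 9 a^2 + 9/8 b^2, and 9/8 * 2/3 < 1. *)
Fixpoint sqr_bound (k : nat) (x : labels R) : R :=
  if k is j.+1 then
    9 / 8 * (clip (x [::]) * clip (x [::]) * sqr_bound j (subtree L1 x) +
      (1 - clip (x [::])) * (1 - clip (x [::])) * sqr_bound j (subtree L2 x)) +
    9 * (clip (x [::]) * clip (x [::]) *
         (endpoint_incr j (subtree L1 x) * endpoint_incr j (subtree L1 x)))
  else 13 ^+ 2.

Lemma sqr_bound_ge0 k x : 0 <= sqr_bound k x.
Proof.
elim: k x => [|k IH] x /=; first by rewrite exprn_ge0.
have c0 := clip_gt0 (x [::]); have c1 := clip_lt1 (x [::]).
have := IH (subtree L1 x); have := IH (subtree L2 x) => h2 h1.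
apply: addr_ge0; first by apply: mulr_ge0; [lra|];
  apply: addr_ge0; apply: mulr_ge0 => //; rewrite -expr2 sqr_ge0.
by rewrite mulr_ge0// mulr_ge0// -expr2 sqr_ge0.
Qed.

Lemma bdmeas_root (f : R -> R) : bdmeas f -> bdmeas (fun x : labels R => f (x [::])).
Proof. by move=> bf; apply: bdmeas_comp bf; exact: measurable_label. Qed.

Lemma bdmeas_subtree i (f : labels R -> R) : bdmeas f ->
  bdmeas (fun x => f (subtree i x)).
Proof. by move=> bf; apply: bdmeas_comp bf; exact: measurable_subtree. Qed.

Let bc : bdmeas (fun x : labels R => clip (x [::])).
Proof. exact: bdmeas_root bdmeas_clip. Qed.

Let bc1 : bdmeas (fun x : labels R => 1 - clip (x [::])).
Proof. exact: bdmeasB (bdmeas_cst 1) bc. Qed.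

Lemma bdmeas_endpoint_incr k : bdmeas (endpoint_incr k).
Proof.
elim: k => [|k IH] /=; first exact: bdmeas_root bdmeas_Cost_clip.
by apply: bdmeasD; apply: bdmeasM => //; exact: bdmeas_subtree.
Qed.

Lemma bdmeas_sqr_bound k : bdmeas (sqr_bound k).
Proof.
elim: k => [|k IH] /=; first exact: bdmeas_cst.
have be := bdmeas_subtree L1 (bdmeas_endpoint_incr k).
have bs i := bdmeas_subtree i IH.
apply: bdmeasD; apply: bdmeasM; try exact: bdmeas_cst.
  by apply: bdmeasD; apply: bdmeasM => //; apply: bdmeasM.
by apply: bdmeasM; apply: bdmeasM.
Qed.

Variables (mu : probability R R) (nu : probability (labels R) R).
Hypothesis mu_unif : forall B, measurable B ->
  mu B = lebesgue_measure (B `&` `[0, 1]).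
Hypothesis nu_cons : forall A : set (labels R), measurable A ->
  nu A = prod_prob mu (prod_prob nu nu) (cons_labels @^-1` A).

Let bc' : @bdmeas _ R R clip. Proof. exact: bdmeas_clip. Qed.
Let bc1' : @bdmeas _ R R (fun u => 1 - clip u).
Proof. exact: bdmeasB (bdmeas_cst 1) bc'. Qed.

Lemma Rintegral_left f g : bdmeas f -> bdmeas g ->
  \int[nu]_x (f (x [::]) * g (subtree L1 x)) =
  (\int[mu]_t f t) * (\int[nu]_x g x).
Proof.
move=> bf bg.
have := Rintegral_cons nu_cons bf bg (bdmeas_cst 1).
rewrite Rintegral_cst1 mulr1 => <-.
by apply: eq_Rintegral => x _; rewrite mulr1.
Qed.

Lemma Rintegral_right f g : bdmeas f -> bdmeas g ->
  \int[nu]_x (f (x [::]) * g (subtree L2 x)) =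
  (\int[mu]_t f t) * (\int[nu]_x g x).
Proof.
move=> bf bg.
have := Rintegral_cons nu_cons bf (bdmeas_cst 1) bg.
rewrite Rintegral_cst1 mul1r => <-.
by apply: eq_Rintegral => x _; rewrite mul1r.
Qed.

Lemma Rintegral_root f : bdmeas f ->
  \int[nu]_x f (x [::]) = \int[mu]_t f t.
Proof.
move=> bf; have := Rintegral_left bf (bdmeas_cst 1).
rewrite Rintegral_cst1 mulr1 => <-.
by apply: eq_Rintegral => x _; rewrite mulr1.
Qed.

Lemma Rintegral_endpoint_incr k : \int[nu]_x endpoint_incr k x = 0.
Proof.
elim: k => [|k IH] /=.
  by rewrite (Rintegral_root bdmeas_Cost_clip) Rintegral_Cost_clip.
have be := bdmeas_endpoint_incr k.
rewrite bd_RintegralD; last 2 first.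
- by apply: bdmeasM => //; exact: bdmeas_subtree.
- by apply: bdmeasM => //; exact: bdmeas_subtree.
rewrite (Rintegral_left bc' be) (Rintegral_right bc1' be) IH; ring.
Qed.

Lemma Rintegral_endpoint_incr_sqrS k :
  \int[nu]_x (endpoint_incr k.+1 x * endpoint_incr k.+1 x) =
  2 / 3 * \int[nu]_x (endpoint_incr k x * endpoint_incr k x).
Proof.
have be := bdmeas_endpoint_incr k.
have bee := bdmeasM be be.
have bcc := bdmeasM bc' bc'.
have bcc1 := bdmeasM bc1' bc1'.
have bcr : @bdmeas _ R R (fun u => 2 * (clip u * (1 - clip u))).
  by apply: bdmeasM; [exact: bdmeas_cst|exact: bdmeasM].
pose e i x := endpoint_incr k (subtree i x).
have bei i : bdmeas (e i) by exact: bdmeas_subtree.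
pose c (x : labels R) := clip (x [::]).
transitivity (\int[nu]_x (c x * c x * (e L1 x * e L1 x) +
   (2 * (c x * (1 - c x)) * (e L1 x * e L2 x) +
   (1 - c x) * (1 - c x) * (e L2 x * e L2 x)))).
  by apply: eq_Rintegral => x _; rewrite /= -/(c x) -/(e L1 x) -/(e L2 x); ring.
have b1 : bdmeas (fun x => c x * c x * (e L1 x * e L1 x)).
  by apply: bdmeasM; apply: bdmeasM.
have b2 : bdmeas (fun x => 2 * (c x * (1 - c x)) * (e L1 x * e L2 x)).
  by apply: bdmeasM; [exact: (bdmeas_root bcr)|exact: bdmeasM].
have b3 : bdmeas (fun x => (1 - c x) * (1 - c x) * (e L2 x * e L2 x)).
  by apply: bdmeasM; apply: bdmeasM.
rewrite bd_RintegralD//; last exact: bdmeasD.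
rewrite bd_RintegralD//.
have -> := Rintegral_left bcc bee.
(* The cross term: by independence of the subtrees it is a multiple of the squared mean of
   [endpoint_incr k], hence zero. *)
have -> := Rintegral_cons nu_cons bcr be be.
have -> := Rintegral_right bcc1 bee.
rewrite Rintegral_clip_sqr// Rintegral_clipC_sqr// Rintegral_endpoint_incr.
by field.
Qed.

Lemma Rintegral_endpoint_incr_sqr k :
  \int[nu]_x (endpoint_incr k x * endpoint_incr k x) <= 25 * (2 / 3) ^+ k.
Proof.
elim: k => [|k IH]; last first.
  by rewrite Rintegral_endpoint_incr_sqrS exprS; lra.
rewrite expr0 mulr1 -[leRHS](Rintegral_cst1 nu).
have b := bdmeas_endpoint_incr 0.
apply: le_Rintegral => //.
- exact: (bdmeas_integrable nu (bdmeasM b b)).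
- exact: (bdmeas_integrable nu (bdmeas_cst 25)).
- move=> x _ /=.
  have : `|Cost (clip (x [::]))| <= 5.
    by apply: Cost_bound; apply: ltW; [exact: clip_gt0|exact: clip_lt1].
  by rewrite ler_norml => /andP[? ?]; nra.
Qed.

Lemma Rintegral_sqr_boundS k :
  \int[nu]_x sqr_bound k.+1 x =
  3 / 4 * (\int[nu]_x sqr_bound k x) +
  3 * \int[nu]_x (endpoint_incr k x * endpoint_incr k x).
Proof.
have be := bdmeas_endpoint_incr k.
have bq := bdmeas_sqr_bound k.
have bee := bdmeasM be be.
have bcc := bdmeasM bc' bc'.
have bcc1 := bdmeasM bc1' bc1'.
have b1 := bdmeasM (bdmeas_root bcc) (bdmeas_subtree L1 bq).
have b2 := bdmeasM (bdmeas_root bcc1) (bdmeas_subtree L2 bq).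
have b3 := bdmeasM (bdmeas_root bcc) (bdmeas_subtree L1 bee).
have b12 := bdmeasD b1 b2.
rewrite /= bd_RintegralD; last 2 first.
- exact: bdmeasM (bdmeas_cst _) b12.
- exact: bdmeasM (bdmeas_cst _) b3.
rewrite !bd_RintegralZ// bd_RintegralD//.
have -> := Rintegral_left bcc bq.
have -> := Rintegral_right bcc1 bq.
have -> := Rintegral_left bcc bee.
rewrite Rintegral_clip_sqr// Rintegral_clipC_sqr//.
by field.
Qed.

(* The recursion is solved by a combination of (3/4)^k and (2/3)^k. *)
Lemma Rintegral_sqr_bound : exists2 C : R, 0 <= C &
  forall k, \int[nu]_x sqr_bound k x <= C * (3 / 4) ^+ k.
Proof.
pose q k := \int[nu]_x sqr_bound k x.
pose s k := \int[nu]_x (endpoint_incr k x * endpoint_incr k x).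
have [a a0 qa] : exists2 a, 0 <= a & q 0%N = a.
  by exists (q 0%N) => //; apply: Rintegral_ge0 => x _; exact: sqr_bound_ge0.
have [b b0 sb] : exists2 b, 0 <= b & forall k, s k <= b * (2 / 3) ^+ k.
  by exists 25 => // k; exact: Rintegral_endpoint_incr_sqr.
have qS k : q k.+1 = 3 / 4 * q k + 3 * s k by exact: Rintegral_sqr_boundS.
(* The number 36 is 3 / (3/4 - 2/3): subtracting 36 b (2/3)^k absorbs the forcing term 3 s_k, and
   the coefficient a + 36 b makes the sharper bound an equality at k = 0. *)
exists (a + 36 * b) => [|k]; first by lra.
have p0 : 0 <= (2 / 3 : R) ^+ k by apply: exprn_ge0; lra.
suff : q k <= (a + 36 * b) * (3 / 4) ^+ k - 36 * (b * (2 / 3) ^+ k).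
  by move=> /le_trans; apply; rewrite gerBl; apply: mulr_ge0 => //; exact: mulr_ge0.
elim: k {p0} => [|k IH]; first by rewrite !expr0 qa; lra.
rewrite qS !exprS; have := sb k; move: IH.
move: (q k) (s k) ((3 / 4) ^+ k) ((2 / 3) ^+ k) => qk sk u v h1 h2.
have -> : b * (2 / 3 * v) = 2 / 3 * (b * v) by ring.
have -> : (a + 36 * b) * (3 / 4 * u) = 3 / 4 * ((a + 36 * b) * u) by ring.
by move: (b * v) (_ * u) h1 h2 => w z; lra.
Qed.

(** The constant ranges over natural numbers so that the set is a countable union. The rate 7/8
    leaves room above the mean rate 3/4. *)
Definition summable_tree : set (labels R) :=
  [set x | exists N : nat, forall k, sqr_bound k x <= N%:R * (7 / 8) ^+ k].

Lemma measurable_summable_tree : measurable summable_tree.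
Proof.
have -> : summable_tree = \bigcup_N \bigcap_k
    (sqr_bound k @^-1` `]-oo, (N%:R * (7 / 8) ^+ k)%R]).
  apply/seteqP; split => x /=.
    by move=> [N H]; exists N => // k _ /=; rewrite in_itv/=.
  by move=> [N _ H]; exists N => k; have := H k I; rewrite /= in_itv.
apply: bigcupT_measurable => N; apply: bigcapT_measurable => k.
have [mq _] := bdmeas_sqr_bound k.
by rewrite -[X in measurable X]setTI; exact: mq.
Qed.

(** The series of (8/7)^k [sqr_bound k] has finite mean, because 8/7 * 3/4 = 6/7 < 1; it is
    therefore almost surely finite, and it bounds each of its terms. *)
Lemma summable_tree_ae : nu (~` summable_tree) = 0%E.
Proof.
have [C C0 HC] := Rintegral_sqr_bound.
pose f k x : \bar R := ((8 / 7) ^+ k * sqr_bound k x)%:E.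
have f0 k x : (0 <= f k x)%E.
  by rewrite lee_fin mulr_ge0 ?sqr_bound_ge0// exprn_ge0//; lra.
have bf k := bdmeasM (bdmeas_cst ((8 / 7) ^+ k)) (bdmeas_sqr_bound k).
have mf k : measurable_fun setT (f k).
  by apply: measurableT_comp => //; have [] := bf k.
have int : (\int[nu]_x \big[+%E/0%E]_(0 <= k <oo) f k x <= (7 * C)%:E)%E.
  rewrite integral_nneseries//.
  apply: lime_le; first by apply: is_cvg_nneseries => k _ _; exact: integral_ge0.
  apply: nearW => n.
  rewrite (eq_bigr (fun k => (\int[nu]_x ((8 / 7) ^+ k * sqr_bound k x))%:E)); last first.
    by move=> k _; rewrite -bdmeas_integral.
  rewrite sumEFin lee_fin.
  (* The closed form of the sum of C (6/7)^k over k < n. *)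
  apply: (@le_trans _ _ (7 * C - 7 * C * (6 / 7) ^+ n)); last first.
    by rewrite gerBl; apply: mulr_ge0; [lra|apply: exprn_ge0; lra].
  elim: n => [|n IH]; first by rewrite big_geq// expr0; lra.
  rewrite big_nat_recr//= bd_RintegralZ; last exact: bdmeas_sqr_bound.
  have p0 : 0 <= (8 / 7 : R) ^+ n by apply: exprn_ge0; lra.
  have := ler_wpM2l p0 (HC n); rewrite mulrCA -exprMn.
  have -> : 8 / 7 * (3 / 4) = 6 / 7 :> R by field.
  rewrite exprS; move: ((6 / 7) ^+ n) IH => u IH h.
  have -> : 7 * C * (6 / 7 * u) = 6 * (C * u) by field.
  have E : 7 * C * u = 7 * (C * u) by ring.
  by rewrite E in IH; move: (C * u) IH h => w; lra.
have mF : measurable_fun setT (fun x => \big[+%E/0%E]_(0 <= k <oo) f k x).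
  exact: ge0_emeasurable_sum.
have : nu.-integrable setT (fun x => \big[+%E/0%E]_(0 <= k <oo) f k x).
  apply/integrableP; split => //.
  apply: (@le_lt_trans _ _ (7 * C)%:E); last by rewrite ltry.
  apply: le_trans int; rewrite le_eqVlt; apply/orP; left; apply/eqP.
  by apply: eq_integral => x _; rewrite gee0_abs//; exact: nneseries_ge0.
move=> /(integrable_ae measurableT) [Z [mZ Z0 HZ]].
apply/eqP; rewrite eq_le measure_ge0 andbT -Z0.
apply: le_measure; rewrite ?inE//; first exact: measurableC measurable_summable_tree.
apply: subset_trans HZ; apply: subsetC => x /= /(_ I) fin.
have [N hN] : exists N : nat, fine (\big[+%E/0%E]_(0 <= k <oo) f k x) <= N%:R.
  exists (Num.truncn (fine (\big[+%E/0%E]_(0 <= k <oo) f k x))).+1.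
  by rewrite ltW// truncnS_gt.
exists N => k.
have : (f k x <= \big[+%E/0%E]_(0 <= k <oo) f k x)%E.
  have := @nneseries_lim_ge _ (f ^~ x) xpredT 0 k.+1 (fun n _ _ => f0 n x).
  rewrite big_nat_recr//=; apply: le_trans.
  by rewrite leeDr// sume_ge0.
rewrite -(fineK fin) lee_fin => h.
have : (8 / 7) ^+ k * sqr_bound k x <= N%:R by exact: le_trans h hN.
have p0 : 0 <= (7 / 8 : R) ^+ k by apply: exprn_ge0; lra.
move=> /(ler_wpM2l p0).
rewrite mulrA -exprMn (_ : 7 / 8 * (8 / 7) = 1 :> R); last by field.
by rewrite expr1n mul1r mulrC.
Qed.

End moments.

(** * The Skorokhod metric *)

Section skorokhod.
Context {R : realType}.
Implicit Types (f g h : Dspace R) (l : R -> R).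

(** Time changes as increasing bijections of [0,1]: continuity and fixed endpoints follow from
    monotonicity and surjectivity, so inverting, composing and gluing need no continuity
    argument. *)
Definition unit_iso l :=
  [/\ forall s t, 0 <= s -> t <= 1 -> s < t -> l s < l t,
      forall t, 0 <= t <= 1 -> 0 <= l t <= 1 &
      forall y, 0 <= y <= 1 -> exists2 x, 0 <= x <= 1 & l x = y].

Lemma time_change_unit_iso l : time_change l -> unit_iso l.
Proof.
move=> [cl [il [l0 l1]]].
have inc s t : 0 <= s -> t <= 1 -> s < t -> l s < l t.
  by move=> s0 t1 st; apply: il => //; rewrite in_itv/=; lra.
have rng t : 0 <= t <= 1 -> 0 <= l t <= 1.
  move=> /andP[t0 t1]; apply/andP; split.
    move: t0; rewrite le_eqVlt => /predU1P[<-|t0]; first by rewrite l0.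
    by rewrite -l0 ltW// inc.
  move: t1; rewrite le_eqVlt => /predU1P[->|t1]; first by rewrite l1.
  by rewrite -l1 ltW// inc.
split => // y y01.
have [|x x01 <-] := @IVT R l 0 1 y ler01 cl.
  by rewrite l0 l1 min_l ?max_r.
by exists x => //; move: x01; rewrite in_itv.
Qed.

Lemma unit_iso_time_change l : unit_iso l -> time_change l.
Proof.
move=> [inc rng sur].
have mono s t : 0 <= s <= 1 -> 0 <= t <= 1 -> (l s <= l t) = (s <= t).
  move=> /andP[s0 s1] /andP[t0 t1]; have [st|ts|->] := ltgtP s t; last by rewrite lexx.
    by rewrite ltW// inc.
  by apply/negbTE; rewrite -ltNge inc.
have l0 : l 0 = 0.
  have [|x x01 lx] := sur 0; first by rewrite lexx ler01.
  have : l 0 <= l x by rewrite mono ?lexx ?ler01//; case/andP: x01.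
  have : 0 <= l 0 <= 1 by apply: rng; rewrite lexx ler01.
  by rewrite lx => ? ?; lra.
have l1 : l 1 = 1.
  have [|x x01 lx] := sur 1; first by rewrite lexx ler01.
  have : l x <= l 1 by rewrite mono ?lexx ?ler01//; case/andP: x01.
  have : 0 <= l 1 <= 1 by apply: rng; rewrite lexx ler01.
  by rewrite lx => ? ?; lra.
split; last split => //.
  apply: segment_inc_surj_continuous.
    by move=> s t; rewrite !in_itv/=; exact: mono.
  move=> y /=; rewrite in_itv/= l0 l1 => /sur[x x01 <-].
  by exists x; rewrite //= in_itv.
by move=> s t; rewrite !in_itv/= => /andP[s0 _] /andP[_ t1]; exact: inc.
Qed.

Definition skor_le f g (d : R) := exists2 l, unit_iso l &
  forall t, 0 <= t <= 1 -> `|l t - t| <= d /\ `|Dval f t - Dval g (l t)| <= d.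

Lemma skor_ltP f g e : skor_lt f g e <-> exists2 d, d < e & skor_le f g d.
Proof.
split=> [[l [d [tl [de H]]]]|[d de [l tl H]]].
  by exists d => //; exists l => //; exact: time_change_unit_iso.
by exists l, d; split => //; exact: unit_iso_time_change.
Qed.

Lemma skor_le_sym f g d : skor_le f g d -> skor_le g f d.
Proof.
move=> [l [inc rng sur] H].
have [k kP] : {k : R -> R & forall y, 0 <= y <= 1 -> 0 <= k y <= 1 /\ l (k y) = y}.
  apply: (@choice _ _ (fun y x => 0 <= y <= 1 -> 0 <= x <= 1 /\ l x = y)) => y.
  have [/sur[x]|] := pselect (0 <= y <= 1); first by exists x.
  by exists 0.
have kl t : 0 <= t <= 1 -> k (l t) = t.
  move=> t01; have [k01 lk] := kP _ (rng _ t01).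
  move: t01 k01 => /andP[t0 t1] /andP[k0 k1].
  by have [h|h|//] := ltgtP (k (l t)) t; [have := inc _ _ k0 t1 h|have := inc _ _ t0 k1 h];
    rewrite lk ltxx.
exists k; last first.
  move=> t t01; have [k01 lk] := kP _ t01; have := H _ k01; rewrite lk.
  by rewrite distrC (distrC (Dval f _)).
split.
- move=> s t s0 t1 st; have [k0 ls] := kP s ltac:(lra); have [k1 lt] := kP t ltac:(lra).
  move: k0 k1 => /andP[? ?] /andP[? ?].
  rewrite ltNge; apply/negP; rewrite le_eqVlt => /predU1P[E|/inc].
    by move: st; rewrite -ls -lt E ltxx.
  by move=> /(_ ltac:(done) ltac:(done)); rewrite ls lt ltNge ltW.
- by move=> t /kP[].
- by move=> x x01; exists (l x); [exact: rng|exact: kl].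
Qed.

Lemma skor_le_trans f g h d e :
  skor_le f g d -> skor_le g h e -> skor_le f h (d + e).
Proof.
move=> [l [inc rng sur] H] [k [inc' rng' sur'] K].
exists (k \o l); last first.
  move=> t t01 /=; have [h1 h2] := H _ t01; have [k1 k2] := K _ (rng _ t01).
  split.
    by rewrite -(subrKA (l t)) (le_trans (ler_normD _ _))// addrC lerD.
  by rewrite -(subrKA (Dval g (l t))) (le_trans (ler_normD _ _))// lerD.
split.
- move=> s t s0 t1 st /=; apply: inc'; last exact: inc.
    by have /rng/andP[] : 0 <= s <= 1 by lra.
  by have /rng/andP[] : 0 <= t <= 1 by lra.
- by move=> t t01 /=; apply: rng'; exact: rng.
- move=> y /sur'[x /sur[z z01 <-] <-]; by exists z.
Qed.

Lemma skor_lt_trans f g h d e :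
  skor_lt f g d -> skor_lt g h e -> skor_lt f h (d + e).
Proof.
move=> /skor_ltP[a ad fg] /skor_ltP[b be gh]; apply/skor_ltP.
by exists (a + b); [exact: ltrD|exact: skor_le_trans fg gh].
Qed.

Lemma skor_lt_sym f g d : skor_lt f g d -> skor_lt g f d.
Proof.
by move=> /skor_ltP[a ad fg]; apply/skor_ltP; exists a => //; exact: skor_le_sym.
Qed.

Lemma skor_le_unif f g d : 0 <= d ->
  (forall t, 0 <= t <= 1 -> `|Dval f t - Dval g t| <= d) -> skor_le f g d.
Proof.
move=> d0 H; exists idfun; last first.
  by move=> t t01 /=; rewrite subrr normr0; split => //; exact: H.
by split => // y y01; exists y.
Qed.

End skorokhod.

(** * Càdlàg functions and the quicksort operator *)

Section cadlag.
Context {R : realType}.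
Implicit Types (f g h : R -> R).

Definition rcll f :=
  forall t, f x @[x --> t^'+] --> f t /\ cvg (f x @[x --> t^'-]).

Lemma rcll_continuous f : continuous f -> rcll f.
Proof.
move=> cf t; split; first exact: cvg_at_right_filter (cf t).
by apply: cvgP; exact: cvg_at_left_filter (cf t).
Qed.

Lemma rcllD f g : rcll f -> rcll g -> rcll (fun t => f t + g t).
Proof.
by move=> rf rg t; have [f1 f2] := rf t; have [g1 g2] := rg t; split;
  [exact: cvgD|exact: is_cvgD].
Qed.

Lemma rcll_cst c : rcll (fun=> c).
Proof. by apply: rcll_continuous => x; exact: cvg_cst. Qed.

Lemma rcllZ c f : rcll f -> rcll (fun t => c * f t).
Proof.
by move=> rf t; have [f1 f2] := rf t; split;
  [apply: cvgM => //; exact: cvg_cst|apply: is_cvgM => //; exact: is_cvg_cst].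
Qed.

Lemma rcll_affine a b f : 0 < a -> rcll f -> rcll (fun t => f (a * t + b)).
Proof.
move=> a0 rf t; have [f1 f2] := rf (a * t + b).
have cr : a * x + b @[x --> t^'+] --> (a * t + b)^'+.
  move=> A [e /= e0 H]; exists (e / a) => /=; first by rewrite divr_gt0.
  move=> x /= tx lt; apply: H; last by rewrite ltrD2r ltr_pM2l.
  rewrite /= (_ : a * t + b - (a * x + b) = a * (t - x)); last by ring.
  by rewrite normrM (gtr0_norm a0) mulrC -ltr_pdivlMr.
have cl : a * x + b @[x --> t^'-] --> (a * t + b)^'-.
  move=> A [e /= e0 H]; exists (e / a) => /=; first by rewrite divr_gt0.
  move=> x /= tx lt; apply: H; last by rewrite ltrD2r ltr_pM2l.
  rewrite /= (_ : a * t + b - (a * x + b) = a * (t - x)); last by ring.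
  by rewrite normrM (gtr0_norm a0) mulrC -ltr_pdivlMr.
split; first exact: cvg_comp cr f1.
by move/cvg_ex : f2 => [l f2]; apply: cvgP; exact: cvg_comp cl f2.
Qed.

(** At t = u the value and the right limit come from [g], the left limit from [f]; the two pieces
    need not agree there. *)
Lemma rcll_glue u f g : rcll f -> rcll g ->
  rcll (fun t => if t < u then f t else g t).
Proof.
move=> rf rg t; have [f1 f2] := rf t; have [g1 g2] := rg t; split.
  have [tu|ut] := ltP t u.
    apply: cvg_trans f1; apply: near_eq_cvg; near=> x.
    by rewrite ifT//; near: x; exact: nbhs_right_lt.
  apply: cvg_trans g1; apply: near_eq_cvg; near=> x.
  have tx : t < x by near: x; exact: nbhs_right_gt.
  by rewrite ltNge (le_trans ut (ltW tx)).
have [tu|ut] := leP t u.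
  move/cvg_ex : f2 => [l f2]; apply/cvg_ex; exists l.
  apply: cvg_trans f2; apply: near_eq_cvg; near=> x.
  by rewrite ifT// (lt_le_trans _ tu)//; near: x; exact: nbhs_left_lt.
move/cvg_ex : g2 => [l g2]; apply/cvg_ex; exists l.
apply: cvg_trans g2; apply: near_eq_cvg; near=> x.
have ux : u < x by near: x; exact: nbhs_left_gt.
by rewrite ltNge (ltW ux).
Unshelve. all: by end_near. Qed.

Lemma rcll_uniform_limit f :
  (forall e, 0 < e -> exists2 g, rcll g & forall t, `|g t - f t| <= e) -> rcll f.
Proof.
move=> H t; split.
  apply/cvgrPdist_le => e e0; have [g rg gf] := H (e / 3) ltac:(lra).
  have [g1 _] := rg t; near=> x.
  have : `|g t - g x| <= e / 3.
    by near: x; move/cvgrPdist_le : g1; apply; lra.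
  have := gf t; have := gf x; rewrite !ler_norml.
  by move=> /andP[? ?] /andP[? ?] /andP[? ?]; apply/andP; split; lra.
apply/cauchy_cvgP; apply/cauchyP => e e0; have [g rg gf] := H (e / 4) ltac:(lra).
have [_ /cvg_ex[l gl]] := rg t; exists l.
have : \forall x \near t^'-, `|l - g x| <= e / 4.
  by move/cvgrPdist_le : gl; apply; lra.
apply: filterS => x /= lg; rewrite /ball/=.
have := gf x; move: lg; rewrite !ler_norml ltr_norml.
by move=> /andP[? ?] /andP[? ?]; apply/andP; split; lra.
Unshelve. all: by end_near. Qed.

End cadlag.

Section quicksort_operator.
Context {R : realType}.
Implicit Types (f g : Dspace R) (u t : R).

Lemma cadlag01P (f : R -> R) : cadlag01 f <->
  [/\ rcll f, forall t, t < 0 -> f t = f 0 & forall t, 1 < t -> f t = f 1].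
Proof.
split=> [[f1 [f2 [f3 f4]]]|[f1 f2 f3]]; first by split => // t; split.
by split=> [t|]; [case: (f1 t)|split=> // t; case: (f1 t)].
Qed.

(** The bracket of [Cost2]. Truncating t at 0 makes the left piece of a split path constant on the
    negative axis, as the encoding of paths demands. *)
Definition toll u t : R :=
  -1 + u + xlnx (1 - Num.max t 0) - xlnx (1 - u) - xlnx (u - Num.max t 0).

Lemma continuous_toll u : continuous (toll u).
Proof.
have cm c : continuous (fun t : R => c - Num.max t 0).
  by move=> t; apply: cvgB; [exact: cvg_cst|
    apply: (@continuous_max _ _ (fun t : R => t) (fun=> 0)) => //; exact: cvg_cst].
have cx c : continuous (fun t : R => xlnx (c - Num.max t 0)).
  by move=> t; apply: (@continuous_comp _ _ _ (fun t : R => c - Num.max t 0) (@xlnx R));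
    [exact: cm|exact: continuous_xlnx].
move=> t; apply: cvgB; last exact: cx.
by apply: cvgB; [apply: cvgD; [exact: cvg_cst|exact: cx]|exact: cvg_cst].
Qed.

(* Extended beyond [0, 1] so as to be constant on both sides. *)
Definition split_fun u (f g : R -> R) (t : R) : R :=
  (if t < u then u * f (t / u) + 2 * toll u t
   else u * f 1 + (1 - u) * g ((t - u) / (1 - u))) + Cost u.

Lemma split_fun_cadlag u (f g : R -> R) : 0 < u -> u < 1 ->
  cadlag01 f -> cadlag01 g -> cadlag01 (split_fun u f g).
Proof.
move=> u0 u1 /cadlag01P[rf f0 f1] /cadlag01P[rg g0 g1]; apply/cadlag01P; split.
- have rf' : rcll (fun t => f (t / u)).
    have := rcll_affine 0 (_ : 0 < u^-1) rf; rewrite invr_gt0 => /(_ u0).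
    by congr rcll; apply/funext => t; rewrite addr0 mulrC.
  have v0 : 0 < 1 - u by lra.
  have rg' : rcll (fun t => g ((t - u) / (1 - u))).
    have := rcll_affine (- u / (1 - u)) (_ : 0 < (1 - u)^-1) rg.
    rewrite invr_gt0 => /(_ v0).
    by congr rcll; apply/funext => t; congr g; rewrite mulrBl mulNr mulrC.
  apply: rcllD; last exact: rcll_cst.
  apply: rcll_glue.
    by apply: rcllD; apply: rcllZ => //; apply: rcll_continuous; exact: continuous_toll.
  by apply: rcllD; [exact: rcll_cst|exact: rcllZ].
- move=> t t0; rewrite /split_fun (lt_trans t0 u0) u0 f0; last first.
    by rewrite ltr_pdivrMr// mul0r.
  by rewrite mul0r /toll maxxx max_r// ltW.
- move=> t t1; rewrite /split_fun !ltNge (ltW u1) (ltW (lt_trans u1 t1))/=.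
  by rewrite g1 ?divff// ?ltr_pdivlMr ?mul1r; lra.
Qed.

Definition split_path u f g : Dspace R :=
  exist _ (split_fun (clip u) (Dval f) (Dval g))
    (split_fun_cadlag (clip_gt0 u) (clip_lt1 u) (proj2_sig f) (proj2_sig g)).

Lemma split_pathE u f g t : 0 <= t <= 1 -> Dval (split_path u f g) t =
  (if t < clip u then clip u * Dval f (t / clip u)
   else clip u * Dval f 1 + (1 - clip u) * Dval g ((t - clip u) / (1 - clip u)))
  + Cost2 t (clip u).
Proof.
move=> /andP[t0 t1]; rewrite /= /split_fun /Cost2 /toll max_l//.
by case: ifP => _; ring.
Qed.

Lemma cadlag01_cst (c : R) : cadlag01 (fun=> c).
Proof. by apply/cadlag01P; split => //; exact: rcll_cst. Qed.

Definition cst_path (c : R) : Dspace R := exist _ (fun=> c) (cadlag01_cst c).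

End quicksort_operator.

(** * Skorokhod continuity of the quicksort operator *)

Section splitting_continuity.
Context {R : realType}.
Implicit Types (f g : Dspace R) (u t : R) (l : R -> R).

(** The bracket of [Cost2] tends to x - 1 as t increases to x, so the cost jumps there and both
    times must lie on the same side of their labels. The constant collects 4 w from [Cost] and 6 w
    from the bracket. *)
Lemma Cost2_close (t t' p q r w : R) :
  0 <= t -> 0 <= t' -> 0 < p -> p < 1 -> 0 < q -> q < 1 -> (t < p) = (t' < q) ->
  `|p - q| <= r ->
  (forall x y, x <= 1 -> y <= 1 -> `|x - y| <= `|p - q| + `|t - t'| ->
     `|xlnx x - xlnx y| <= w) ->
  `|Cost2 t p - Cost2 t' q| <= 10 * w + 2 * r.
Proof.
move=> t0 t0' p0 p1 q0 q1 tpq pqr H.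
have h1 : `|xlnx p - xlnx q| <= w.
  by apply: H; [exact: ltW|exact: ltW|rewrite lerDl].
have h2 : `|xlnx (1 - p) - xlnx (1 - q)| <= w.
  apply: H; [by rewrite gerBl ltW|by rewrite gerBl ltW|].
  by rewrite (_ : 1 - p - (1 - q) = - (p - q)); [rewrite normrN lerDl|ring].
move: pqr h1 h2; rewrite /Cost2 /Cost -tpq !ler_norml.
move=> /andP[? ?] /andP[? ?] /andP[? ?].
case: ifP => tp; last by apply/andP; split; lra.
have : t' < q by rewrite -tpq.
move=> tq'.
have h3 : `|xlnx (1 - t) - xlnx (1 - t')| <= w.
  apply: H; [by rewrite gerBl|by rewrite gerBl|].
  by rewrite (_ : 1 - t - (1 - t') = - (t - t')); [rewrite normrN lerDr|ring].
have h4 : `|xlnx (p - t) - xlnx (q - t')| <= w.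
  apply: H; first by rewrite lerBlDr ler_wpDr// ltW.
    by rewrite lerBlDr ler_wpDr// ltW.
  rewrite (_ : p - t - (q - t') = (p - q) - (t - t')); last by ring.
  exact: ler_normB.
move: h3 h4; rewrite !ler_norml => /andP[? ?] /andP[? ?].
by apply/andP; split; lra.
Qed.

Lemma divr_01 t u : 0 <= t -> t <= u -> 0 < u -> 0 <= t / u <= 1.
Proof. by move=> t0 tu u0; rewrite ler_pdivrMr// mul1r tu divr_ge0// ltW. Qed.

Lemma divr_01_lt t u : 0 <= t -> t < u -> 0 < u -> 0 <= t / u < 1.
Proof. by move=> t0 tu u0; rewrite ltr_pdivrMr// mul1r tu divr_ge0// ltW. Qed.

(** Rescales [l1] to map [0,p] onto [0,q] and [l2] to map [p,1] onto [q,1]; in particular p goes to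
    q, which aligns the jumps of the two split paths. *)
Definition split_time (p q : R) l1 l2 t : R :=
  if t < p then q * l1 (t / p) else q + (1 - q) * l2 ((t - p) / (1 - p)).

Section split_time.
Variables (p q : R) (l1 l2 : R -> R).
Hypotheses (p0 : 0 < p) (p1 : p < 1) (q0 : 0 < q) (q1 : q < 1).
Hypotheses (i1 : unit_iso l1) (i2 : unit_iso l2).

Let left_arg t : 0 <= t -> t < p -> 0 <= t / p < 1.
Proof. by move=> t0 tp; exact: divr_01_lt. Qed.

Let right_arg t : p <= t -> t <= 1 -> 0 <= (t - p) / (1 - p) <= 1.
Proof. by move=> tp t1; apply: divr_01; rewrite ?subr_ge0 ?subr_gt0// lerB. Qed.

Lemma split_time_left t : 0 <= t -> t < p ->
  [/\ split_time p q l1 l2 t = q * l1 (t / p), 0 <= l1 (t / p) & l1 (t / p) < 1].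
Proof.
move=> t0 tp; rewrite /split_time tp; have /andP[a b] := left_arg t0 tp.
have [inc rng _] := i1; have [_ [_ [_ <-]]] := unit_iso_time_change i1.
split => //; last exact: inc.
by have /andP[] : 0 <= l1 (t / p) <= 1 by apply: rng; rewrite a ltW.
Qed.

Lemma split_time_right t : p <= t -> t <= 1 ->
  split_time p q l1 l2 t = q + (1 - q) * l2 ((t - p) / (1 - p)) /\
  0 <= l2 ((t - p) / (1 - p)) <= 1.
Proof.
move=> pt t1; rewrite /split_time ltNge pt/=; split => //.
by have [_ rng _] := i2; apply: rng; exact: right_arg.
Qed.

Lemma split_time_lt t : 0 <= t <= 1 -> (split_time p q l1 l2 t < q) = (t < p).
Proof.
move=> /andP[t0 t1]; have [tp|pt] := ltP t p.
  by have [-> _ a] := split_time_left t0 tp; rewrite gtr_pMr.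
have [-> /andP[a _]] := split_time_right pt t1.
by apply/negbTE; rewrite -leNgt lerDl mulr_ge0// subr_ge0 ltW.
Qed.

Lemma split_time_iso : unit_iso (split_time p q l1 l2).
Proof.
have [inc1 rng1 sur1] := i1; have [inc2 rng2 sur2] := i2.
split.
- move=> s t s0 t1 st; have [tp|pt] := ltP t p.
    have sp : s < p by exact: lt_trans tp.
    have t0 : 0 <= t by rewrite (le_trans s0)// ltW.
    have [-> _ _] := split_time_left s0 sp; have [-> _ _] := split_time_left t0 tp.
    rewrite ltr_pM2l//; apply: inc1.
    + by apply: divr_ge0 => //; exact: ltW.
    + by apply: ltW; have /andP[] := left_arg t0 tp.
    + by rewrite ltr_pM2r// invr_gt0.
  have t0 : 0 <= t by rewrite (le_trans s0)// ltW.
  have [sp|ps] := ltP s p.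
    rewrite (@lt_le_trans _ _ q)//; first by rewrite split_time_lt// s0 ltW// (lt_le_trans st).
    by rewrite leNgt split_time_lt ?t0// -leNgt.
  have [-> _] := split_time_right ps (ltW (lt_le_trans st t1)).
  have [-> _] := split_time_right pt t1.
  rewrite ltrD2l ltr_pM2l ?subr_gt0//; apply: inc2.
  + by rewrite divr_ge0// subr_ge0// ltW.
  + by have /andP[] := right_arg pt t1.
  + by rewrite ltr_pM2r ?invr_gt0 ?subr_gt0// ltrD2r.
- move=> t /andP[t0 t1]; have [tp|pt] := ltP t p.
    have [-> a b] := split_time_left t0 tp.
    by rewrite mulr_ge0 ?(ltW q0)//= mulr_ile1 ?(ltW q0) ?(ltW q1) ?(ltW b).
  have [-> /andP[a b]] := split_time_right pt t1.
  have q1' : 0 <= 1 - q by rewrite subr_ge0 ltW.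
  rewrite addr_ge0 ?(ltW q0) ?mulr_ge0//= -lerBrDl.
  exact: ler_piMr.
- move=> y /andP[y0 y1]; have [yq|qy] := ltP y q.
    have yq1 : 0 <= y / q < 1 by exact: divr_01_lt.
    have [|z /andP[z0 z1] lz] := sur1 (y / q); first by case/andP: yq1 => -> /ltW.
    have {}z1 : z < 1.
      rewrite lt_neqAle z1 andbT; apply/eqP => z1'.
      have [_ [_ [_ l11]]] := unit_iso_time_change i1.
      by move: yq1; rewrite -lz z1' l11 ltxx andbF.
    exists (p * z).
      by rewrite mulr_ge0 ?(ltW p0)//= mulr_ile1 ?(ltW p0) ?(ltW p1) ?(ltW z1).
    rewrite /split_time gtr_pMr// z1 (mulrC p) mulfK ?gt_eqF// lz mulrC divfK ?gt_eqF//.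
  have [|z /andP[z0 z1] lz] := sur2 ((y - q) / (1 - q)).
    by apply: divr_01; rewrite ?subr_ge0 ?subr_gt0// lerB.
  have p1' : 0 <= 1 - p by rewrite subr_ge0 ltW.
  exists (p + (1 - p) * z).
    rewrite addr_ge0 ?(ltW p0) ?mulr_ge0//= -lerBrDl.
    exact: ler_piMr.
  have h : 1 - p != 0 by rewrite gt_eqF ?subr_gt0.
  have h' : 1 - q != 0 by rewrite gt_eqF ?subr_gt0.
  rewrite /split_time ifF; last by apply/negbTE; rewrite -leNgt lerDl mulr_ge0.
  rewrite (_ : (p + (1 - p) * z - p) / (1 - p) = z); last by field.
  by rewrite lz; field.
Qed.

End split_time.

Lemma ler_norm_mix (a b x y r d B : R) :
  `|a| <= r -> `|x| <= B -> 0 <= b <= 1 -> `|y| <= d ->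
  `|a * x + b * y| <= r * B + d.
Proof.
move=> ar xB /andP[b0 b1] yd; apply: le_trans (ler_normD _ _) _.
apply: lerD; rewrite normrM; first exact: ler_pM.
by rewrite (ger0_norm b0) (le_trans _ yd)// ler_piMl.
Qed.

(** Under [split_time] the arguments passed to the subpaths are matched by [l1] and [l2] themselves.
    The time moves by at most r + d, so [xlnx] is compared at distance at most r + (r + d). *)
Lemma skor_le_split (u v d r w M : R) f g f' g' :
  0 <= M ->
  (forall t, 0 <= t <= 1 -> `|Dval f' t| <= M) ->
  (forall t, 0 <= t <= 1 -> `|Dval g' t| <= M) ->
  `|clip u - clip v| <= r -> skor_le f f' d -> skor_le g g' d ->
  (forall x y, x <= 1 -> y <= 1 -> `|x - y| <= 2 * r + d ->
     `|xlnx x - xlnx y| <= w) ->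
  skor_le (split_path u f g) (split_path v f' g')
    (2 * (r * M + d) + (10 * w + 3 * r)).
Proof.
move=> M0 Mf Mg; move: (clip_gt0 u) (clip_lt1 u) (clip_gt0 v) (clip_lt1 v).
set p := clip u; set q := clip v => p0 p1 q0 q1 pqr [l1 i1 H1] [l2 i2 H2] W.
have r0 : 0 <= r := le_trans (normr_ge0 _) pqr.
have d0 : 0 <= d.
  by have [|h _] := H1 0; [rewrite lexx ler01|exact: le_trans (normr_ge0 _) h].
have w0 : 0 <= w.
  have := W 0 0 ler01 ler01; rewrite !subrr normr0; apply.
  by rewrite addr_ge0// mulr_ge0.
have rM0 : 0 <= r * M by exact: mulr_ge0.
have iso := split_time_iso p0 p1 q0 q1 i1 i2.
exists (split_time p q l1 l2) => // t t01.
have /andP[t0 t1] := t01.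
have lt01 : 0 <= split_time p q l1 l2 t <= 1 by have [_ + _] := iso; apply.
have time : `|split_time p q l1 l2 t - t| <= r + d.
  have [tp|pt] := ltP t p.
    have [-> a b] := split_time_left q l2 p0 i1 t0 tp.
    have [h _] := H1 (t / p) (divr_01 t0 (ltW tp) p0).
    have tE : t = p * (t / p) by rewrite mulrC divfK// gt_eqF.
    rewrite {2}tE; move: (t / p) (l1 _) a b h => s ls a b h.
    rewrite (_ : q * ls - p * s = (q - p) * ls + p * (ls - s)); last by ring.
    rewrite -[r]mulr1; apply: ler_norm_mix => //; first by rewrite distrC.
      by rewrite ger0_norm// ltW.
    by rewrite !ltW.
  have [-> /andP[a b]] := split_time_right q l1 p1 i2 pt t1.
  have h1p : 0 < 1 - p by rewrite subr_gt0.
  have [|h _] := H2 ((t - p) / (1 - p)).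
    by apply: divr_01; rewrite ?subr_ge0// lerB.
  have tE : t = p + (1 - p) * ((t - p) / (1 - p)) by field; rewrite gt_eqF.
  rewrite {2}tE; move: ((t - p) / (1 - p)) (l2 _) a b h => s ls a b h.
  rewrite (_ : q + (1 - q) * ls - (p + (1 - p) * s) =
    (q - p) * (1 - ls) + (1 - p) * (ls - s)); last by ring.
  rewrite -[r]mulr1; apply: ler_norm_mix => //; first by rewrite distrC.
    by rewrite ger0_norm ?subr_ge0// gerBl.
  by rewrite ltW//= gerBl ltW.
split.
  apply: le_trans time _; move: rM0 r0 d0 w0; clear; move: (r * M) => k; lra.
rewrite !split_pathE// -/p -/q (split_time_lt p0 p1 q0 q1 i1 i2 t01).
set A := (X in X + _ - _); set B := (X in _ + _ - (X + _)).
have AB : `|A - B| <= 2 * (r * M + d).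
  rewrite /A /B; have [tp|pt] := ltP t p.
    have [-> a b] := split_time_left q l2 p0 i1 t0 tp.
    have [_ h] := H1 (t / p) (divr_01 t0 (ltW tp) p0).
    have := Mf (l1 (t / p)) ltac:(by rewrite a ltW).
    rewrite (_ : q * l1 (t / p) / q = l1 (t / p)); last by field; rewrite gt_eqF.
    move: (Dval f _) (Dval f' _) h => x y h yM.
    rewrite (_ : p * x - q * y = (p - q) * y + p * (x - y)); last by ring.
    apply: (@le_trans _ _ (r * M + d)).
      by apply: ler_norm_mix => //; rewrite !ltW.
    by rewrite ler_peMl ?ler1n// addr_ge0.
  have [-> ab] := split_time_right q l1 p1 i2 pt t1.
  have h1p : 0 < 1 - p by rewrite subr_gt0.
  have [|_ h] := H2 ((t - p) / (1 - p)).
    by apply: divr_01; rewrite ?subr_ge0// lerB.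
  rewrite (_ : (q + (1 - q) * _ - q) / _ = l2 ((t - p) / (1 - p))); last first.
    by field; rewrite gt_eqF// subr_gt0.
  have := Mg _ ab; have [|_ h'] := H1 1; first by rewrite ler01 lexx.
  have [_ [_ [_ l11]]] := unit_iso_time_change i1; rewrite l11 in h'.
  have := Mf 1; rewrite ler01 lexx => /(_ isT).
  move: (Dval f _) (Dval f' _) (Dval g _) (Dval g' _) h h' => x y z k h h' yM kM.
  (* Each pair separates a change of weight, at most r against a path value bounded by M, from a
     change of path value, at most d under a weight in [0,1]; two pairs give the factor 2. *)
  rewrite (_ : p * x + (1 - p) * z - (q * y + (1 - q) * k) =
    ((p - q) * y + p * (x - y)) + ((q - p) * k + (1 - p) * (z - k))); last by ring.
  rewrite (_ : 2 * (r * M + d) = (r * M + d) + (r * M + d)); last by ring.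
  apply: le_trans (ler_normD _ _) _; apply: lerD; apply: ler_norm_mix => //.
  - by rewrite !ltW.
  - by rewrite distrC.
  - by rewrite ltW//= gerBl ltW.
have CC : `|Cost2 t p - Cost2 (split_time p q l1 l2 t) q| <= 10 * w + 2 * r.
  apply: Cost2_close => //; first by case/andP: lt01.
    by rewrite (split_time_lt p0 p1 q0 q1 i1 i2 t01).
  by move=> x y x1 y1 xy; apply: W => //; rewrite (distrC t) in xy; lra.
rewrite [X in `|X|](_ : _ = (A - B) +
  (Cost2 t p - Cost2 (split_time p q l1 l2 t) q)); last by ring.
apply: le_trans (ler_normD _ _) _; apply: lerD => //.
by apply: le_trans CC _; rewrite lerD2l ler_wpM2r// ler_nat.
Qed.

Lemma split_path_continuous (M e : R) : 0 <= M -> 0 < e -> exists2 d, 0 < d &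
  forall u v f g f' g',
  (forall t, 0 <= t <= 1 -> `|Dval f' t| <= M) ->
  (forall t, 0 <= t <= 1 -> `|Dval g' t| <= M) ->
  `|clip u - clip v| < d -> skor_lt f f' d -> skor_lt g g' d ->
  skor_lt (split_path u f g) (split_path v f' g') e.
Proof.
(* With w = e/20 the term 10 w takes e/2. The bound d <= c/4 gives 3 d < c, and d <= e / (8 (2 + M))
   keeps the remaining d (2 M + 5) strictly below e/2. *)
move=> M0 e0; have [c c0 H] := @xlnx_unif_continuous R (e / 20) ltac:(lra).
have k0 : 0 < e / (8 * (2 + M)) by apply: divr_gt0 => //; lra.
have kE : e / (8 * (2 + M)) * (8 * (2 + M)) = e by rewrite divfK// gt_eqF//; lra.
exists (Num.min (c / 4) (e / (8 * (2 + M)))); first by rewrite lt_min k0 divr_gt0.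
move=> u v f g f' g' Mf Mg uv /skor_ltP[a ad fa] /skor_ltP[b bd gb].
set d := Num.min _ _ in uv ad bd.
have d1 : d <= c / 4 by rewrite ge_min lexx.
have d2 : d <= e / (8 * (2 + M)) by rewrite ge_min lexx orbT.
have weak (f1 f2 : Dspace R) x : x < d -> skor_le f1 f2 x -> skor_le f1 f2 d.
  move=> xd [l il K]; exists l => // t /K[k1 k2].
  by split; [apply: le_trans k1 _|apply: le_trans k2 _]; exact: ltW.
have Wd x y : x <= 1 -> y <= 1 -> `|x - y| <= 2 * d + d ->
    `|xlnx x - xlnx y| <= e / 20.
  by move=> x1 y1 xy; apply: ltW; apply: H => //; lra.
have K := skor_le_split M0 Mf Mg (ltW uv) (weak _ _ _ ad fa) (weak _ _ _ bd gb) Wd.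
apply/skor_ltP; eexists; last exact: K.
move: d d2 {uv ad bd d1 fa gb weak Wd K} => d d2.
move: (e / (8 * _)) kE d2 k0 => k kE d2 k0.
have : d * M <= k * M by rewrite ler_wpM2r.
have : 0 <= k * M by rewrite mulr_ge0// ltW.
by lra.
Qed.

End splitting_continuity.

(** * Measurability *)

Section measurable_paths.
Context {R : realType}.

Lemma skor_lt_weaken (f g : Dspace R) d e : d <= e -> skor_lt f g d -> skor_lt f g e.
Proof.
move=> de /skor_ltP[a ad H]; apply/skor_ltP; exists a => //; exact: lt_le_trans de.
Qed.

(** The sets with measurable preimage form a sigma-algebra, so open sets suffice. *)
Lemma D_rv_open {d} {T : measurableType d} (Y : T -> Dspace R) :
  (forall A, skor_open A -> measurable (Y @^-1` A)) -> D_rv Y.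
Proof.
move=> H B sB.
have : image_set_system setT Y measurable B.
  apply: sB; split => [|A oA].
    by apply: sigma_algebra_image; exact: sigma_algebra_measurable.
  by rewrite /image_set_system /= setTI; exact: H.
by rewrite /image_set_system /= setTI.
Qed.

(** The inequality on the radius is strict, which leaves the margin that makes this set open. *)
Definition deep (A : set (Dspace R)) (k : nat) : set (Dspace R) :=
  [set f | exists2 r : R, k.+1%:R^-1 < r & forall g, skor_lt f g r -> A g].

Lemma skor_open_deep A k : skor_open (deep A k).
Proof.
move=> f [r kr H]; have [h1 h2] := midf_lt kr.
set c := (_ / 2) in h1 h2.
exists (r - c); first by rewrite subr_gt0.
move=> g fg; exists c => // h gh; apply: H.
by rewrite -(subrK c r); exact: skor_lt_trans fg gh.
Qed.

(* Y lies in the open set A iff, for some k, all but finitely many Z_n lie in A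
   at distance more than 1/k from its complement. *)
Lemma D_rv_limit {d} {T : measurableType d} (Z : nat -> T -> Dspace R)
    (Y : T -> Dspace R) :
  (forall n, D_rv (Z n)) ->
  (forall x e, 0 < e -> \forall n \near \oo, skor_lt (Y x) (Z n x) e) -> D_rv Y.
Proof.
move=> mZ ZY; apply: D_rv_open => A oA.
have -> : Y @^-1` A = \bigcup_k \bigcap_n
    (if (k <= n)%N then Z n @^-1` deep A k else setT).
  apply/seteqP; split => x /=.
    move=> /oA[e e0 H]; have [N _ hN] := ZY x (e / 2) ltac:(lra).
    (* One index serves twice: beyond it the approximations are within e/2, and as a depth it
       satisfies 1/(k+1) < e/2. *)
    pose k := maxn N (Num.truncn (e / 2)^-1); exists k => // n _ /=.
    case: ifP => //= kn; exists (e / 2).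
      rewrite invf_plt ?posrE//; last by lra.
      apply: lt_le_trans (truncnS_gt _) _.
      by rewrite ler_nat ltnS leq_maxr.
    move=> g Zg; apply: H; have -> : e = e / 2 + e / 2 by field.
    apply: skor_lt_trans Zg; apply: hN => /=.
    by apply: leq_trans kn; exact: leq_maxl.
  move=> [k _ H]; have [N _ hN] := ZY x k.+1%:R^-1 ltac:(by rewrite invr_gt0).
  have := H (maxn k N) I; rewrite leq_maxl => -[r kr]; apply.
  apply: skor_lt_sym; apply: skor_lt_weaken (ltW kr) _; apply: hN => /=.
  exact: leq_maxr.
apply: bigcupT_measurable => k; apply: bigcapT_measurable => n.
case: ifP => _ //; apply: mZ; apply: sub_sigma_algebra; exact: skor_open_deep.
Qed.

(** Countably many values, factored through [nat], so the target needs no structure at all and pairs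
    of paths are as good as single paths. *)
Definition discrete_map {d} {T : measurableType d} {X : Type} (Z : T -> X) :=
  exists N : T -> nat, exists psi : nat -> X,
    (forall k, measurable (N @^-1` [set k])) /\ forall x, Z x = psi (N x).

Lemma discrete_map_preimage {d} {T : measurableType d} {X : Type} (Z : T -> X) B :
  discrete_map Z -> measurable (Z @^-1` B).
Proof.
move=> [N [psi [mN ZE]]].
have -> : Z @^-1` B = \bigcup_k (if `[< B (psi k) >] then N @^-1` [set k] else set0).
  apply/seteqP; split => x /=.
    by rewrite ZE => BN; exists (N x) => //; case: asboolP.
  by move=> [k _]; case: asboolP => // Bk /= Nx; rewrite ZE Nx.
by apply: bigcupT_measurable => k; case: ifP.
Qed.

Lemma discrete_map2 {d} {T : measurableType d} {X1 X2 X3 : Type}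
    (h : X1 -> X2 -> X3) (Z1 : T -> X1) (Z2 : T -> X2) :
  discrete_map Z1 -> discrete_map Z2 -> discrete_map (fun x => h (Z1 x) (Z2 x)).
Proof.
move=> [N1 [psi1 [m1 E1]]] [N2 [psi2 [m2 E2]]].
exists (fun x => pickle (N1 x, N2 x)).
exists (fun k => let p := odflt (0%N, 0%N) (unpickle k) in h (psi1 p.1) (psi2 p.2)).
split => [k|x]; last by rewrite pickleK/= E1 E2.
have -> : (fun x => pickle (N1 x, N2 x)) @^-1` [set k] =
    \bigcup_a \bigcup_b (if pickle (a, b) == k then
      N1 @^-1` [set a] `&` N2 @^-1` [set b] else set0).
  apply/seteqP; split => x /=.
    by move=> E; exists (N1 x) => //; exists (N2 x) => //=; rewrite E eqxx.
  by move=> [a _ [b _]]; case: eqP => // <- [/= -> ->].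
apply: bigcupT_measurable => a; apply: bigcupT_measurable => b.
by case: ifP => // _; exact: measurableI.
Qed.

Lemma discrete_map_comp {d d'} {T : measurableType d} {T' : measurableType d'}
    {X : Type} (Z : T -> X) (h : T' -> T) :
  measurable_fun setT h -> discrete_map Z -> discrete_map (Z \o h).
Proof.
move=> mh [N [psi [mN ZE]]]; exists (N \o h), psi; split => [k|x]; last exact: ZE.
by rewrite comp_preimage -[X in measurable X]setTI; exact: mh.
Qed.

Lemma discrete_map_cst {d} {T : measurableType d} {X : Type} (c : X) :
  discrete_map (fun _ : T => c).
Proof.
exists (fun=> 0%N), (fun=> c); split => // k.
by rewrite preimage_cst; case: ifP.
Qed.

(** The midpoint of the cell of width 1/(m+1) containing the clipped label; the shift by one half
    keeps it inside ]0,1[, where [clip] leaves it unchanged. *)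
Definition grid (m : nat) (u : R) : R :=
  ((Num.truncn (m.+1%:R * clip u))%:R + 2^-1) / m.+1%:R.

Lemma grid_clip m u : clip (grid m u) = grid m u /\
  `|clip u - clip (grid m u)| <= m.+1%:R^-1.
Proof.
have m0 : 0 < m.+1%:R :> R by [].
have c0 := clip_gt0 u; have c1 := clip_lt1 u.
have mc : 0 <= m.+1%:R * clip u by rewrite mulr_ge0// ltW.
have /andP[h1 h2] := truncn_itv mc.
set k := Num.truncn _ in h1 h2.
have km : (k <= m)%N.
  by rewrite -ltnS -(ltr_nat R) (le_lt_trans h1)// gtr_pMr.
have km' : k%:R + 1 <= m.+1%:R :> R by rewrite natr1 ler_nat ltnS.
have k0 : 0 <= k%:R :> R by [].
have gE : grid m u = (k%:R + 2^-1) / m.+1%:R by [].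
have {}h2 : m.+1%:R * clip u < k%:R + 1 by rewrite natr1.
move: gE h1 h2 km' k0; clear km; move: (k%:R) => a gE h1 h2 km' k0.
have g01 : 0 < grid m u < 1.
  rewrite gE divr_gt0//=; last by lra.
  by rewrite ltr_pdivrMr// mul1r; apply: lt_le_trans km'; lra.
split; first exact: clip_id.
rewrite (clip_id g01) gE.
have cE : clip u = (m.+1%:R * clip u) / m.+1%:R by rewrite mulrC mulKf// gt_eqF.
rewrite {1}cE -mulrBl normrM (gtr0_norm (x := m.+1%:R^-1)) ?invr_gt0//.
rewrite -[leRHS]mul1r ler_wpM2r// ?invr_ge0// ler_norml.
by move: (m.+1%:R * clip u) h1 h2 => z h1 h2; apply/andP; split; lra.
Qed.

Lemma discrete_grid m : discrete_map (fun x : labels R => grid m (x [::])).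
Proof.
exists (fun x => Num.truncn (m.+1%:R * clip (x [::]))).
exists (fun k => (k%:R + 2^-1) / m.+1%:R); split => // k.
have -> : (fun x : labels R => Num.truncn (m.+1%:R * clip (x [::]))) @^-1` [set k] =
    (fun x : labels R => m.+1%:R * clip (x [::])) @^-1` `[k%:R, k.+1%:R[.
  have E (x : labels R) := @truncn_eq _ (m.+1%:R * clip (x [::])) k
    (mulr_ge0 (ler0n _ _) (ltW (clip_gt0 _))).
  by apply/seteqP; split => x /=; rewrite in_itv/= -E => /eqP.
have [mc _] : bdmeas (fun x : labels R => m.+1%:R * clip (x [::])).
  by apply: bdmeasM; [exact: bdmeas_cst|exact: (bdmeas_root bdmeas_clip)].
by rewrite -[X in measurable X]setTI; exact: mc.
Qed.

Fixpoint approx (n : nat) (x : labels R) : Dspace R :=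
  if n is m.+1 then
    split_path (x [::]) (approx m (subtree L1 x)) (approx m (subtree L2 x))
  else cst_path 0.

Lemma split_path_bound u (f g : Dspace R) M :
  (forall t, 0 <= t <= 1 -> `|Dval f t| <= M) ->
  (forall t, 0 <= t <= 1 -> `|Dval g t| <= M) ->
  forall t, 0 <= t <= 1 -> `|Dval (split_path u f g) t| <= M + 13.
Proof.
move=> fM gM t t01; rewrite split_pathE//; have /andP[t0 t1] := t01.
have c0 := clip_gt0 u; have c1 := clip_lt1 u.
have c1' : 0 < 1 - clip u by rewrite subr_gt0.
apply: le_trans (ler_normD _ _) _; apply: lerD; last first.
  by apply: Cost2_bound => //; exact: ltW.
have [tu|ut] := ltP t (clip u).
  have := fM _ (divr_01 t0 (ltW tu) c0) => h.
  by rewrite normrM (gtr0_norm c0) (le_trans _ h)// ler_piMl// ltW.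
have := gM _ (@divr_01 _ (t - clip u) (1 - clip u) ltac:(by rewrite subr_ge0)
  ltac:(by rewrite lerB) c1') => h.
have h1 := fM 1 ltac:(by rewrite ler01 lexx).
apply: le_trans (ler_normD _ _) _; rewrite !normrM (gtr0_norm c0) (gtr0_norm c1').
move: (`|Dval f _|) (`|Dval g _|) h h1 => a b bM aM.
have -> : M = clip u * M + (1 - clip u) * M by ring.
by apply: lerD; rewrite ler_wpM2l// ltW.
Qed.

(** Crude in n but uniform in the labels, which is what [split_path_continuous] asks of the paths
    approached. *)
Lemma approx_bound n x t : 0 <= t <= 1 -> `|Dval (approx n x) t| <= 13 * n%:R.
Proof.
elim: n x t => [|n IH] x t t01; first by rewrite /= normr0 mulr0.
by rewrite -[n.+1%:R]natr1 mulrDr mulr1; apply: split_path_bound t01; exact: IH.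
Qed.

(** Since [clip] jumps at 0 and at 1, convergence is required of the clipped labels; the grid points
    provide exactly that. *)
Lemma approx_continuous n (x : labels R) (y : nat -> labels R) :
  (forall v, clip (y m v) @[m --> \oo] --> clip (x v)) ->
  forall e, 0 < e -> \forall m \near \oo, skor_lt (approx n x) (approx n (y m)) e.
Proof.
elim: n x y => [|n IH] x y yx e e0.
  apply: nearW => m; apply/skor_ltP; exists 0 => //.
  by apply: skor_le_unif => // t _; rewrite subrr normr0.
have [d d0 H] := @split_path_continuous R (13 * n%:R) e ltac:(by rewrite mulr_ge0) e0.
have h1 := IH (subtree L1 x) (fun m => subtree L1 (y m)) (fun v => yx (L1 :: v)) d d0.
have h2 := IH (subtree L2 x) (fun m => subtree L2 (y m)) (fun v => yx (L2 :: v)) d d0.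
have h0 : \forall m \near \oo, `|clip (x [::]) - clip (y m [::])| < d.
  by have /cvgrPdist_lt := yx [::]; apply.
near=> m; apply: H.
- by move=> t; exact: approx_bound.
- by move=> t; exact: approx_bound.
- by near: m.
- by near: m.
- by near: m.
Unshelve. all: by end_near. Qed.

Lemma discrete_approx n m :
  discrete_map (fun x : labels R => approx n (fun v => grid m (x v))).
Proof.
elim: n => [|n IH]; first exact: discrete_map_cst.
have h i := discrete_map_comp (measurable_subtree (R := R) i) IH.
have h12 := discrete_map2 pair (h L1) (h L2).
exact: (discrete_map2 (fun u p => split_path u p.1 p.2) (discrete_grid m) h12).
Qed.

Lemma D_rv_approx n : D_rv (approx n).
Proof.
apply: (D_rv_limit (Z := fun m (x : labels R) => approx n (fun v => grid m (x v)))).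
  by move=> m B _; apply: discrete_map_preimage; exact: discrete_approx.
move=> x e e0; apply: approx_continuous e0 => v.
apply/cvgrPdist_le => r r0; near=> m.
have [_] := grid_clip m (x v); move/le_trans; apply.
rewrite -[leRHS]invrK lef_pV2 ?posrE ?invr_gt0//.
apply: ltW; apply: lt_le_trans (truncnS_gt _) _; rewrite ler_nat ltnS.
by near: m; exact: nbhs_infty_ge.
Unshelve. all: by end_near. Qed.

End measurable_paths.

(** * The limit *)

Section limit.
Context {R : realType}.

(** The toll cancels in the increment. Right of the split, the increment contains that of the left
    subpath at 1, so the bound and the endpoint identity must be proved together. *)
Lemma approx_incr k (x : labels R) :
  (forall t, 0 <= t <= 1 ->
     (Dval (approx k.+1 x) t - Dval (approx k x) t) ^+ 2 <= sqr_bound k x) /\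
  Dval (approx k.+1 x) 1 - Dval (approx k x) 1 = endpoint_incr k x.
Proof.
elim: k x => [|k IH] x.
  have c0 := clip_gt0 (x [::]); have c1 := clip_lt1 (x [::]).
  split=> [t t01|]; rewrite [approx 1 x]/= split_pathE//= ?ler01 ?lexx// !mulr0 ?addr0 ?if_same
    subr0 add0r.
    rewrite -real_normK ?num_real// ler_sqr ?nnegrE//.
    by case/andP: t01 => ? ?; apply: Cost2_bound => //; exact: ltW.
  exact: Cost21.
have c0 := clip_gt0 (x [::]); have c1 := clip_lt1 (x [::]).
have c1' : 0 < 1 - clip (x [::]) by rewrite subr_gt0.
have aE n t (t01 : 0 <= t <= 1) : Dval (approx n.+1 x) t = _ :=
  split_pathE (x [::]) (approx n (subtree L1 x)) (approx n (subtree L2 x)) t01.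
have [I1 E1] := IH (subtree L1 x); have [I2 E2] := IH (subtree L2 x).
move: aE I1 E1 I2 E2; move: (approx) => ap aE I1 E1 I2 E2.
split; last first.
  have l01 : 0 <= (1 : R) <= 1 by rewrite ler01 lexx.
  rewrite !aE// ltNge (ltW c1)/= divff ?gt_eqF//.
  by rewrite -E1 -E2 /=; ring.
move=> t t01; have /andP[t0 t1] := t01.
rewrite !aE// [sqr_bound _ _]/=.
have q1 := sqr_bound_ge0 k (subtree L1 x); have q2 := sqr_bound_ge0 k (subtree L2 x).
set c := clip _ in c0 c1 c1' *.
have [tc|ct] := ltP t c.
  have := I1 _ (divr_01 t0 (ltW tc) c0).
  set a := Dval _ _; set b := Dval _ _ => h.
  rewrite (_ : _ - _ = c * (a - b)); last by ring.
  rewrite exprMn.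
  have h2 : c ^+ 2 * (a - b) ^+ 2 <= c ^+ 2 * sqr_bound k (subtree L1 x).
    by rewrite ler_wpM2l// sqr_ge0.
  have h3 : 0 <= c ^+ 2 * sqr_bound k (subtree L1 x) by rewrite mulr_ge0// sqr_ge0.
  have h4 : 0 <= (1 - c) ^+ 2 * sqr_bound k (subtree L2 x) by rewrite mulr_ge0// sqr_ge0.
  have h5 : 0 <= c ^+ 2 * endpoint_incr k (subtree L1 x) ^+ 2 by rewrite mulr_ge0// sqr_ge0.
  rewrite -!expr2; apply: le_trans h2 _; move: h3 h4 h5.
  move: (c ^+ 2 * _) ((1 - c) ^+ 2 * _) (c ^+ 2 * _) => X Y Z; lra.
have := I2 _ (@divr_01 _ (t - c) (1 - c) ltac:(by rewrite subr_ge0)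
  ltac:(by rewrite lerB) c1').
set a := Dval _ _; set b := Dval _ _ => h.
rewrite -E1; set e := Dval _ 1; set e' := Dval _ 1.
rewrite (_ : _ - _ = c * (e - e') + (1 - c) * (a - b)); last by ring.
have h2 : ((1 - c) * (a - b)) ^+ 2 <= (1 - c) ^+ 2 * sqr_bound k (subtree L2 x).
  by rewrite exprMn ler_wpM2l// sqr_ge0.
have h3 : 0 <= c ^+ 2 * sqr_bound k (subtree L1 x) by rewrite mulr_ge0// sqr_ge0.
rewrite -!expr2 -exprMn; move: (c * (e - e')) ((1 - c) * (a - b)) h2 => X Y.
move: ((1 - c) ^+ 2 * _) (c ^+ 2 * _) h3 => A B B0 YA.
(* (X + Y)^2 <= (9/8) Y^2 + 9 X^2 *)
have := sqr_ge0 (8 * X - Y); rewrite !expr2 in YA *; nra.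
Qed.

(** Since 16 = 1 / (1 - 15/16), subtracting the tail bound from u gives an increasing sequence and
    adding it a decreasing one; the supremum of the former lies between the two. *)
Lemma geometric_limit (u : nat -> R) (c : R) : 0 <= c ->
  (forall k, `|u k.+1 - u k| <= c * (15 / 16) ^+ k) ->
  {l | forall n, `|u n - l| <= 16 * c * (15 / 16) ^+ n}.
Proof.
move=> c0 H.
pose a n := u n - 16 * c * (15 / 16) ^+ n; pose b n := u n + 16 * c * (15 / 16) ^+ n.
have p0 n : 0 <= c * (15 / 16) ^+ n.
  by rewrite mulr_ge0// exprn_ge0// divr_ge0.
have pE n : 16 * c * (15 / 16) ^+ n.+1 = 15 * (c * (15 / 16) ^+ n).
  by rewrite exprS; move: (_ ^+ n) => z; field.
have pE' n : 16 * c * (15 / 16) ^+ n = 16 * (c * (15 / 16) ^+ n) by rewrite mulrA.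
have inca : {homo a : n m / (n <= m)%N >-> n <= m}.
  apply: homo_leq => [//|y x z|n]; first exact: le_trans.
  rewrite /a pE pE'; have := H n; rewrite ler_norml => /andP[]; lra.
have decb : {homo b : n m / (n <= m)%N >-> m <= n}.
  apply: (@homo_leq _ b (fun x y => y <= x)) => [x //|y x z xy yz|n].
    exact: le_trans yz xy.
  rewrite /b pE pE'; have := H n; rewrite ler_norml => /andP[]; lra.
have ab n m : a n <= b m.
  apply: (@le_trans _ _ (a (maxn n m))); first by apply: inca; exact: leq_maxl.
  apply: (@le_trans _ _ (b (maxn n m))); last by apply: decb; exact: leq_maxr.
  by rewrite /a /b pE'; have := p0 (maxn n m); lra.
have sa : has_sup (range a).
  by split; [exists (a 0%N); exists 0%N|exists (b 0%N) => _ [n _ <-]].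
exists (sup (range a)) => n; rewrite ler_distlC; apply/andP; split.
  by apply: ub_le_sup; [case: sa|exists n].
rewrite -/(b n); apply: ge_sup; first by case: sa.
by move=> _ [m _ <-].
Qed.

Lemma cadlag_limit (f : nat -> Dspace R) (c : R) : 0 <= c ->
  (forall k t, 0 <= t <= 1 ->
    `|Dval (f k.+1) t - Dval (f k) t| <= c * (15 / 16) ^+ k) ->
  {g : Dspace R | forall n t, 0 <= t <= 1 ->
    `|Dval (f n) t - Dval g t| <= 16 * c * (15 / 16) ^+ n}.
Proof.
move=> c0 H.
(* Clamping to [0,1] does not change the paths, and composing the pointwise limit with it makes the
   convergence uniform on all of R. *)
pose s (t : R) : R := Num.max 0 (Num.min t 1).
have s01 t : 0 <= s t <= 1.
  by rewrite /s le_max lexx/= ge_max ler01/= ge_min lexx orbT.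
have fs n t : Dval (f n) (s t) = Dval (f n) t.
  have [_ n0 n1] := (cadlag01P _).1 (proj2_sig (f n)); rewrite /s.
  have [t0|t0] := ltP t 0.
    by rewrite min_l ?max_l ?(ltW t0)//; [exact/esym/n0|apply: ltW (lt_trans t0 ltr01)].
  have [t1|t1] := ltP 1 t; last by rewrite max_r.
  by rewrite max_r//; exact/esym/n1.
have [g gP] : {g : R -> R & forall y, 0 <= y <= 1 ->
    forall n, `|Dval (f n) y - g y| <= 16 * c * (15 / 16) ^+ n}.
  apply: (@choice _ _ (fun y z => 0 <= y <= 1 ->
    forall n, `|Dval (f n) y - z| <= 16 * c * (15 / 16) ^+ n)) => y.
  have [y01|] := pselect (0 <= y <= 1); last by exists 0.
  by have [z zP] := geometric_limit c0 (fun k => H k y y01); exists z.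
pose l t := g (s t).
have lP t n : `|Dval (f n) (s t) - l t| <= 16 * c * (15 / 16) ^+ n by exact: gP.
have small e : 0 < e -> exists n, 16 * c * (15 / 16) ^+ n <= e.
  move=> e0; have : (fun n => 16 * c * (15 / 16) ^+ n) @ \oo --> (0 : R).
    rewrite -[0](mulr0 (16 * c)); apply: cvgM; first exact: cvg_cst.
    by apply: cvg_expr; rewrite ger0_norm; lra.
  move=> /cvgrPdist_le/(_ e e0)[N _ HN]; exists N.
  have := HN N (leqnn N); rewrite /= sub0r normrN; apply: le_trans.
  exact: ler_norm.
have cl : cadlag01 l.
  apply/cadlag01P; split.
  - apply: rcll_uniform_limit => e /small[n ne].
    exists (Dval (f n)); first by have [] := (cadlag01P _).1 (proj2_sig (f n)).
    by move=> t; rewrite -fs; exact: le_trans (lP t n) ne.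
  - move=> t t0; rewrite /l (_ : s t = s 0); first by [].
    by rewrite /s !min_l ?ler01 ?maxxx ?max_l ?(ltW t0)// (le_trans (ltW t0)).
  - move=> t t1; rewrite /l (_ : s t = s 1); first by [].
    by rewrite /s !min_r ?(ltW t1).
exists (exist _ l cl) => n t t01 /=.
by have := lP t n; rewrite fs.
Qed.

End limit.

(** * The limit functional and its fixed-point identity *)

Section fixpoint.
Context {R : realType}.

Lemma approx_incr_summable (x : labels R) (N : nat) :
  (forall k, sqr_bound k x <= N%:R * (7 / 8) ^+ k) ->
  forall k t, 0 <= t <= 1 ->
  `|Dval (approx k.+1 x) t - Dval (approx k x) t| <= N%:R * (15 / 16) ^+ k.
Proof.
move=> HN k t t01; have [/(_ t t01) h _] := approx_incr k x.
have p0 : 0 <= (15 / 16 : R) ^+ k by rewrite exprn_ge0// divr_ge0.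
rewrite -ler_sqr ?nnegrE ?mulr_ge0// real_normK ?num_real//.
apply: le_trans h _; apply: le_trans (HN k) _.
rewrite [leRHS]exprMn; have q0 : 0 <= (7 / 8 : R) ^+ k by rewrite exprn_ge0// divr_ge0.
apply: ler_pM => //.
  (* For a natural number N <= N^2, so the same constant bounds the increments themselves. *)
  by rewrite -natrX ler_nat; case: (N) => // n; rewrite expnS leq_pmulr.
(* 7/8 = 224/256 lies below (15/16)^2 = 225/256. *)
rewrite exprAC; apply: lerXn2r; rewrite ?nnegrE; lra.
Qed.

Lemma limit_path_exists : exists F : labels R -> Dspace R, D_rv F /\
  forall x, summable_tree x -> forall e, 0 < e -> \forall n \near \oo,
    forall t, 0 <= t <= 1 -> `|Dval (approx n x) t - Dval (F x) t| <= e.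
Proof.
(* Frozen at 0 off the measurable set of summable trees: [D_rv_limit] needs convergence at every
   tree, not almost every one. *)
pose Z n (x : labels R) := if `[< summable_tree x >] then approx n x else cst_path 0.
have [F FP] : {F : labels R -> Dspace R & forall x e, 0 < e -> \forall n \near \oo,
    forall t, 0 <= t <= 1 -> `|Dval (Z n x) t - Dval (F x) t| <= e}.
  apply: (@choice _ _ (fun x f => forall e, 0 < e -> \forall n \near \oo,
    forall t, 0 <= t <= 1 -> `|Dval (Z n x) t - Dval f t| <= e)) => x.
  rewrite /Z; case: asboolP => [[N HN]|_]; last first.
    by exists (cst_path 0) => e e0; apply: nearW => n t _; rewrite subrr normr0 ltW.
  have [g gP] := cadlag_limit (ler0n R N) (approx_incr_summable HN).
  exists g => e e0.
  have : (fun n => 16 * N%:R * (15 / 16) ^+ n) @ \oo --> (0 : R).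
    rewrite -[0](mulr0 (16 * N%:R)); apply: cvgM; first exact: cvg_cst.
    by apply: cvg_expr; rewrite ger0_norm; lra.
  move=> /cvgrPdist_le/(_ e e0); apply: filterS => n h t t01.
  apply: le_trans (gP n t t01) _; apply: le_trans h.
  by rewrite sub0r normrN ler_norm.
exists F; split; last first.
  by move=> x sx e e0; have := FP x e e0; rewrite /Z; case: asboolP.
apply: (D_rv_limit (Z := Z)) => [n B sB|x e e0].
  have -> : Z n @^-1` B = (summable_tree `&` approx n @^-1` B) `|`
      (~` summable_tree `&` (fun=> cst_path 0) @^-1` B).
    apply/seteqP; split => x; rewrite /Z /=; case: asboolP => sx.
    - by left.
    - by right.
    - by case=> -[].
    - by case=> -[].
  have mS := @measurable_summable_tree R.
  apply: measurableU; apply: measurableI => //.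
  - exact: D_rv_approx.
  - exact: measurableC.
  - by rewrite preimage_cst; case: ifP.
have := FP x (e / 2) ltac:(lra); apply: filterS => n H.
apply: skor_lt_sym; apply/skor_ltP; exists (e / 2); first lra.
apply: skor_le_unif => //; lra.
Qed.

(* Both sides of the recursion depend continuously, in the uniform norm, on the
   paths below the root. *)
Lemma limit_path_split (F : labels R -> Dspace R) (x : labels R) :
  (forall y, [\/ y = x, y = subtree L1 x | y = subtree L2 x] ->
    forall e, 0 < e -> \forall n \near \oo,
    forall t, 0 <= t <= 1 -> `|Dval (approx n y) t - Dval (F y) t| <= e) ->
  forall t, 0 <= t <= 1 ->
  Dval (F x) t = Dval (split_path (x [::]) (F (subtree L1 x)) (F (subtree L2 x))) t.
Proof.
move=> H t t01; apply/eqP; rewrite -subr_eq0 -normr_le0; apply/ler_addgt0Pr => e e0.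
rewrite add0r.
have e4 : 0 < e / 4 by lra.
have := H x (Or31 _ _ erefl) _ e4; have := H _ (Or32 _ _ erefl) _ e4.
have := H _ (Or33 _ _ erefl) _ e4 => -[N3 _ h3] [N2 _ h2] [N1 _ h1].
pose n := maxn N1 (maxn N2 N3).
(* Index n + 1 at the tree and n at its subtrees: iterate n + 1 is exactly the operator applied to
   the iterates n, so only three errors of at most e/4 remain. *)
have {}h1 := h1 n.+1 (leqW (leq_maxl _ _)) t t01.
have {}h2 := h2 n (leq_trans (leq_maxl _ _) (leq_maxr _ _)).
have {}h3 := h3 n (leq_trans (leq_maxr _ _) (leq_maxr _ _)).
have c0 := clip_gt0 (x [::]); have c1 := clip_lt1 (x [::]).
have c1' : 0 < 1 - clip (x [::]) by rewrite subr_gt0.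
have /andP[t0 t1] := t01.
move: h1; rewrite [Dval (approx n.+1 x) t](split_pathE (x [::])
  (approx n (subtree L1 x)) (approx n (subtree L2 x)) t01).
rewrite (split_pathE (x [::]) (F (subtree L1 x)) (F (subtree L2 x)) t01).
move: h2 h3 c0 c1 c1'; move: (clip (x [::])) => c.
move: (approx n (subtree L1 x)) (approx n (subtree L2 x)) => a1 a2.
move: (F (subtree L1 x)) (F (subtree L2 x)) => f1 f2 h2 h3 c0 c1 c1' h1.
have scale z r : 0 <= r <= 1 -> `|z| <= e / 4 -> `|r * z| <= e / 4.
  by move=> /andP[r0 r1] ze; rewrite normrM (ger0_norm r0) (le_trans _ ze)// ler_piMl.
have c01 : 0 <= c <= 1 by rewrite !ltW.
have c01' : 0 <= 1 - c <= 1 by rewrite ltW//= gerBl ltW.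
have [tc|ct] := ltP t c.
  rewrite tc in h1.
  have := scale _ _ c01 (h2 _ (divr_01 t0 (ltW tc) c0)); move: h1.
  rewrite mulrBr !ler_norml => /andP[? ?] /andP[? ?]; apply/andP; split; lra.
rewrite ltNge ct/= in h1.
have := scale _ _ c01 (h2 1 ltac:(by rewrite ler01 lexx)).
have := scale _ _ c01' (h3 _ (@divr_01 _ (t - c) (1 - c) ltac:(by rewrite subr_ge0)
  ltac:(by rewrite lerB) c1')); move: h1.
rewrite !mulrBr !ler_norml => /andP[? ?] /andP[? ?] /andP[? ?].
by apply/andP; split; lra.
Qed.

End fixpoint.

Theorem theorem1 (R : realType) (d : measure_display) (Omega : measurableType d)
    (P : probability Omega R) (U : V -> Omega -> R) :
  (forall v, uniform01 P (U v)) ->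
  mutually_independent P U ->
  exists Y : V -> Omega -> Dspace R,
    (forall v, D_rv (Y v)) /\
    (forall v (B : set (Dspace R)), skor_borel B ->
        P (Y v @^-1` B) = P (Y vroot @^-1` B)) /\
    (forall v : V, {ae P, forall w : Omega, forall t : R, 0 <= t <= 1 ->
        Dval (Y v w) t =
          (if t < U v w then U v w * Dval (Y (child v L1) w) (t / U v w)
           else U v w * Dval (Y (child v L1) w) 1
                + (1 - U v w) * Dval (Y (child v L2) w) ((t - U v w) / (1 - U v w)))
          + Cost2 t (U v w)}).
Proof.
move=> unifU indU.
have [F [mF FP]] := @limit_path_exists R.
pose X := tree_above U.
have mX v : measurable_fun setT (X v) by exact: measurable_tree_above.
exists (fun v w => F (X v w)); split; [|split].
- by move=> v B sB; have := mX v measurableT _ (mF B sB); rewrite setTI.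
- move=> v B sB; transitivity (tree_law unifU (F @^-1` B)).
    by apply: tree_above_law => //; exact: mF.
  by apply/esym; apply: tree_above_law => //; exact: mF.
- move=> v.
  have sX u : {ae P, forall w, summable_tree (X u w)}.
    exists (X u @^-1` ~` summable_tree); split => //.
    + have := mX u measurableT _ (measurableC (@measurable_summable_tree R)).
      by rewrite setTI.
    + rewrite tree_above_law//; last by apply: measurableC; exact: measurable_summable_tree.
      exact: (summable_tree_ae (label_lawE unifU) (tree_law_cons unifU indU)).
  have U01 : {ae P, forall w, 0 < U v w < 1}.
    exists (U v @^-1` ~` `]0, 1[%classic); split.
    + by rewrite -[Y in measurable Y]setTI; have [mU _] := unifU v;
        apply: mU => //; exact: measurableC.
    + have [_ ->] := unifU v; last exact: measurableC.
      rewrite -(label_lawE unifU); last exact: measurableC.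
      by rewrite probability_setC// (mu_oo01 (label_lawE unifU)) subee.
    + by move=> w /= H h; apply: H; move: h; rewrite in_itv.
  (* [child] appends a letter to the vertex while [subtree] strips one from the front of the
     relative word; the two meet in the concatenation. *)
  have sub u i w : subtree i (X u w) = X (child u i) w.
    by apply/funext => z; rewrite /X /tree_above /subtree /child cat_rcons.
  (* Almost surely the trees at the vertex and at both children are summable and the label lies in
     ]0,1[; on this event the identity holds for all t at once. *)
  apply: filterS3 (sX v) (sX (child v L1)) _; last first.
    apply: (filterI (sX (child v L2)) U01).
  move=> w s0 s1 [s2 u01] t t01.
  have XE : X v w [::] = U v w by rewrite /X /tree_above cats0.
  rewrite (limit_path_split (F := F) (x := X v w))//; last first.
    by move=> y [] ->; apply: FP; rewrite ?sub.
  by rewrite !sub split_pathE// XE clip_id.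
Qed.
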